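(* The quantum reading capacity of any environment-parametrized memory cell $\mathcal{E}_{\mathcal{X}}$ with environment states $\{\theta^x_E\}_{x\in\mathcal{X}}$ satisfies $\mathcal{C}(\mathcal{E}_{\mathcal{X}})\le\max_{p_X}I(X;E)_\theta$, where $\theta_{XE}=\sum_xp_X(x)|x\rangle\langle x|_X\otimes\theta^x_E$.
   Context: An environment-parametrized memory cell is a set of channels $\{\mathcal{E}^x_{A\to B}\}_{x\in\mathcal{X}}$ ($\mathcal{X}$ finite) with $\mathcal{E}^x_{A\to B}(\rho_A)=\mathcal{F}_{AE\to B}(\rho_A\otimes\theta^x_E)$ for a fixed channel $\mathcal{F}$ and states $\theta^x_E$. An $(n,R,\varepsilon)$ quantum reading protocol for a memory cell $\{\mathcal{N}^x\}$: messages $\mathcal{M}$ with $R=\frac1n\log_2|\mathcal{M}|$, encoding $m\mapsto x^n(m)\in\mathcal{X}^n$, adaptive strategy (initial state $\rho_{R_1A_1}$, interleaved channels $\mathcal{A}^i_{R_iB_i\to R_{i+1}A_{i+1}}$, final POVM $\{\Lambda^{\hat m}_{R_nB_n}\}$, the $i$-th call applying $\mathcal{N}^{x_i(m)}$ to $A_i$) with average success probability (uniform messages) at least $1-\varepsilon$. A rate $R$ is achievable if for all $\varepsilon\in(0,1)$, $\delta>0$ and all sufficiently large $n$ there is an $(n,R-\delta,\varepsilon)$ protocol; the quantum reading capacity $\mathcal{C}$ is the supremum of achievable rates. $I(X;E)$ is quantum mutual information. *)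

(* Defs.v *)
From mathcomp Require Import all_boot all_order all_algebra.
From mathcomp Require Import classical_sets reals ereal exp.
From mathcomp.real_closed Require Import complex mxtens.
From mathcomp Require Import spectral.

Set Implicit Arguments.
Unset Strict Implicit.
Unset Printing Implicit Defensive.

Import Order.TTheory GRing.Theory Num.Theory.
Local Open Scope ring_scope.

(* A composite system A B of dimensions a, b is C^(a*b), with the      *)
(* index (i,j) encoded by mxtens_index, and A *t B the Kronecker       *)
(* product (mxtens).                                                   *)

Definition dagger {R : rcfType} m n (M : 'M[R[i]]_(m, n)) : 'M[R[i]]_(n, m) :=
  map_mx Num.conj M^T.

Definition psdmx {R : rcfType} n (M : 'M[R[i]]_n) : Prop :=
  dagger M = M /\ forall v : 'cV[R[i]]_n, 0 <= (dagger v *m M *m v) 0 0.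

Definition density {R : rcfType} n (rho : 'M[R[i]]_n) : Prop :=
  psdmx rho /\ \tr rho = 1.

Definition ptrace_B {R : rcfType} a b (M : 'M[R[i]]_(a * b)) : 'M[R[i]]_a :=
  \matrix_(i, j) \sum_(k < b) M (mxtens_index (i, k)) (mxtens_index (j, k)).
Definition ptrace_A {R : rcfType} a b (M : 'M[R[i]]_(a * b)) : 'M[R[i]]_b :=
  \matrix_(i, j) \sum_(k < a) M (mxtens_index (k, i)) (mxtens_index (k, j)).

Definition idtens {R : rcfType} k n m (Phi : 'M[R[i]]_n -> 'M[R[i]]_m)
    (X : 'M[R[i]]_(k * n)) : 'M[R[i]]_(k * m) :=
  \sum_(a < k) \sum_(b < k)
     (delta_mx a b *t Phi (\matrix_(i, j) X (mxtens_index (a, i)) (mxtens_index (b, j)))).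

Arguments idtens {R} k {n m} Phi X.

Definition is_channel {R : rcfType} n m (Phi : 'M[R[i]]_n -> 'M[R[i]]_m) : Prop :=
  [/\ (forall (c : R[i]) X Y, Phi (c *: X + Y) = c *: Phi X + Phi Y),
      (forall X, \tr (Phi X) = \tr X) &
      (forall k (X : 'M[R[i]]_(k * n)), psdmx X -> psdmx (idtens k Phi X))].

Definition is_povm {R : rcfType} (I : finType) n (L : I -> 'M[R[i]]_n) : Prop :=
  (forall k, psdmx (L k)) /\ \sum_k L k = 1%:M.

Definition log2 {R : realType} (t : R) : R := ln t / ln 2.

Definition xlog2x {R : realType} (t : R) : R := if 0 < t then t * log2 t else 0.

(* von Neumann entropy: - sum over the eigenvalues lambda of lambda log2 lambda;
   spectral_diag rho lists the eigenvalues (with multiplicity) of the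
   normal matrix rho (spectral theorem, mathcomp spectral.v). *)
Definition vN_entropy {R : realType} n (rho : 'M[R[i]]_n) : R :=
  - \sum_(k < n) xlog2x (complex.Re (spectral_diag rho 0 k)).

Definition qmutinf {R : realType} a b (rho : 'M[R[i]]_(a * b)) : R :=
  vN_entropy (ptrace_B rho) + vN_entropy (ptrace_A rho) - vN_entropy rho.

Definition is_distr {R : realType} (X : finType) (p : X -> R) : Prop :=
  (forall x, 0 <= p x) /\ \sum_x p x = 1.

Definition cq_state {R : realType} (X : finType) dE (p : X -> R)
    (theta : X -> 'M[R[i]]_dE) : 'M[R[i]]_(#|X| * dE) :=
  \sum_x (((p x)%:C)%C *: (delta_mx (enum_rank x) (enum_rank x) *t theta x)).

Definition max_holevo {R : realType} (X : finType) dE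
    (theta : X -> 'M[R[i]]_dE) : \bar R :=
  ereal_sup [set (qmutinf (cq_state p theta))%:E | p in [set p : X -> R | is_distr p]].

Definition env_memory_cell {R : rcfType} (X : Type) dA dB dE
    (F : 'M[R[i]]_(dA * dE) -> 'M[R[i]]_dB) (theta : X -> 'M[R[i]]_dE)
    (x : X) (rho : 'M[R[i]]_dA) : 'M[R[i]]_dB :=
  F (rho *t theta x).

(* Output state on R_{k+1} B_{k+1} (0-based: after the (k+1)-th call) of an adaptive
   strategy with reference dimensions dR, initial state rho1 on R_1 A_1,
   interleaved channels Ad k : R_{k+1}B_{k+1} -> R_{k+2}A_{k+2}, when the
   i-th call (0-based) applies N (xs i) to the A system. *)
Fixpoint adaptive_run {R : rcfType} (X : Type) dA dB
    (N : X -> 'M[R[i]]_dA -> 'M[R[i]]_dB) (dR : nat -> nat)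
    (rho1 : 'M[R[i]]_(dR 0 * dA))
    (Ad : forall k, 'M[R[i]]_(dR k * dB) -> 'M[R[i]]_(dR k.+1 * dA))
    (xs : nat -> X) (k : nat) : 'M[R[i]]_(dR k * dB) :=
  match k return 'M[R[i]]_(dR k * dB) with
  | 0 => idtens (dR 0) (N (xs 0)) rho1
  | k'.+1 => idtens (dR k'.+1) (N (xs k'.+1)) (Ad k' (adaptive_run N rho1 Ad xs k'))
  end.

(* existence of an (n, (1/n) log2 m, eps) quantum reading protocol with
   message set 'I_m (uniformly distributed), n >= 1 channel uses *)
Definition reading_protocol_exists {R : realType} (X : Type) dA dB
    (N : X -> 'M[R[i]]_dA -> 'M[R[i]]_dB) (n m : nat) (eps : R) : Prop :=
  (0 < n)%N /\
  exists (dR : nat -> nat) (rho1 : 'M[R[i]]_(dR 0 * dA))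
         (Ad : forall k, 'M[R[i]]_(dR k * dB) -> 'M[R[i]]_(dR k.+1 * dA))
         (enc : 'I_m -> nat -> X)
         (Lam : 'I_m -> 'M[R[i]]_(dR n.-1 * dB)),
    [/\ density rho1,
        (forall k, (k.+1 < n)%N -> is_channel (Ad k)),
        is_povm Lam &
        1 - eps <= (m%:R)^-1 *
          \sum_(msg < m) complex.Re (\tr (Lam msg *m adaptive_run N rho1 Ad (enc msg) n.-1))].

Definition achievable_rate {R : realType} (X : Type) dA dB
    (N : X -> 'M[R[i]]_dA -> 'M[R[i]]_dB) (r : R) : Prop :=
  forall eps delta : R, 0 < eps < 1 -> 0 < delta ->
  exists n0 : nat, forall n : nat, (n0 <= n)%N ->
    exists m : nat, (0 < m)%N /\ r - delta <= log2 (m%:R) / n%:R /\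
                    reading_protocol_exists N n m eps.

Definition reading_capacity {R : realType} (X : Type) dA dB
    (N : X -> 'M[R[i]]_dA -> 'M[R[i]]_dB) : \bar R :=
  ereal_sup [set r%:E | r in [set r : R | achievable_rate N r]].

(* Main.v *)
Require Import Defs.
From mathcomp Require Import all_boot all_order all_algebra.
From mathcomp Require Import classical_sets reals ereal exp.
From mathcomp.real_closed Require Import complex mxtens.
From mathcomp Require Import spectral.
From mathcomp Require Import sequences ring lra.

(* A strong-converse argument in the style of Winter and Ogawa-Nagaoka, which avoids the
   monotonicity of quantum relative entropy.  Every environment-parametrized strategy is a
   completely positive image of the product state of the environments, so its decoder is a
   POVM on E^n applied to tensor products of the theta^x.  For the codewords of a fixed
   type p, let omega = sum_x p(x) theta^x.  Compressing the codeword state to its typical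
   eigenvalues (at most 2^-(n sum_x p(x) H(theta^x)) up to the slack) and then to the
   typical eigenvectors of omega^(tensor n) (eigenvalues at least 2^-(n H(omega)) up to the
   slack) costs a vanishing probability by Chebyshev, with variance bounds uniform in p,
   and leaves an operator below 2^(n chi(p)) omega^(tensor n).  Since the POVM elements sum
   to 1, each type contributes at most about 2^(n chi(p)) to the total success probability
   of the messages, and there are only polynomially many types. *)

Set Implicit Arguments.
Unset Strict Implicit.
Unset Printing Implicit Defensive.

Import Order.TTheory GRing.Theory Num.Theory.
Local Open Scope ring_scope.

(** * Positive kernels and typical compression *)

Section Kernels.
Variable C : numClosedFieldType.

(** Positive semidefinite matrices indexed by an arbitrary finite type, so that pairs and call
    histories can serve as indices without being encoded as ordinals. *)
Definition kpsd (T : finType) (K : T -> T -> C) : Prop :=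
  forall w : T -> C, 0 <= \sum_s \sum_t (w s)^* * K s t * w t.

Lemma eq_kpsd (T : finType) (K K' : T -> T -> C) :
  (forall s t, K s t = K' s t) -> kpsd K -> kpsd K'.
Proof.
move=> eK pK w; rewrite (_ : \sum__ _ = \sum_s \sum_t (w s)^* * K s t * w t) //.
by apply: eq_bigr => s _; apply: eq_bigr => t _; rewrite eK.
Qed.

(** [h] may identify or miss points: the test vector is summed over the fibres of [h]. *)
Lemma kpsd_comp (S T : finType) (h : S -> T) (K : T -> T -> C) :
  kpsd K -> kpsd (fun s t => K (h s) (h t)).
Proof.
move=> pK w; have := pK (fun t => \sum_(s | h s == t) w s).
congr (0 <= _); under eq_bigr do under eq_bigr do
  rewrite rmorph_sum mulr_suml mulr_suml; rewrite [RHS](partition_big h xpredT) //=.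
apply: eq_bigr => t _; rewrite exchange_big /=; apply: eq_bigr => s /eqP ehs.
rewrite [RHS](partition_big h xpredT) //=; apply: eq_bigr => t' _.
by rewrite mulr_sumr; apply: eq_bigr => s' /eqP ->; rewrite ehs.
Qed.

Lemma kpsd_diag_ge0 (T : finType) (K : T -> T -> C) a : kpsd K -> 0 <= K a a.
Proof.
move=> /(_ (fun x => if x == a then 1 else 0)).
rewrite (bigD1 a) //= [X in _ + X]big1 ?addr0 => [|b /negPf ->]; last first.
  by rewrite big1 // => d _; rewrite rmorph0 !mul0r.
rewrite (bigD1 a) //= [X in _ + X]big1 ?addr0 => [|b /negPf ->]; last first.
  by rewrite mulr0.
by rewrite eqxx rmorph1 mul1r mulr1.
Qed.

(** The entrywise product with a rank-one kernel is a congruence by a diagonal matrix: [z] is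
    absorbed into the test vector. *)
Lemma kpsd_mul_rank1 (T : finType) (K : T -> T -> C) (z : T -> C) :
  kpsd K -> kpsd (fun s t => K s t * (z s * (z t)^*)).
Proof.
move=> pK w; have := pK (fun t => (z t)^* * w t); congr (0 <= _).
by apply: eq_bigr => s _; apply: eq_bigr => t _; rewrite rmorphM /= conjCK; ring.
Qed.

Lemma kpsd_sum (I T : finType) (K : I -> T -> T -> C) :
  (forall i, kpsd (K i)) -> kpsd (fun s t => \sum_i K i s t).
Proof.
move=> pK w; have : 0 <= \sum_i \sum_s \sum_t (w s)^* * K i s t * w t.
  by apply: sumr_ge0 => i _; exact: pK.
congr (0 <= _); rewrite exchange_big; apply: eq_bigr => s _.
rewrite exchange_big; apply: eq_bigr => t _.
by rewrite mulr_sumr mulr_suml.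
Qed.

Lemma kpsd_sum_fst (I T : finType) (K : T -> T -> C) (h : I -> T -> C) :
  kpsd K -> kpsd (fun i j => \sum_s \sum_t (h i s)^* * K s t * h j t).
Proof.
move=> pK w; have := pK (fun t => \sum_i w i * h i t); congr (0 <= _).
under eq_bigr do under eq_bigr do rewrite rmorph_sum !mulr_suml.
under [RHS]eq_bigr do under eq_bigr do rewrite mulr_sumr mulr_suml.
under [RHS]eq_bigr do rewrite exchange_big.
rewrite [RHS]exchange_big; apply: eq_bigr => s _ /=.
under [RHS]eq_bigr do under eq_bigr do rewrite mulr_sumr mulr_suml.
under [RHS]eq_bigr do rewrite exchange_big.
rewrite [RHS]exchange_big; apply: eq_bigr => t _ /=; apply: eq_bigr => i _.
rewrite mulr_sumr; apply: eq_bigr => j _.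
by rewrite rmorphM; ring.
Qed.

(** The value of the test [c] on the vector [w]. The entry [w a * (w b)^*] meets [c a b] without
    transposition, the convention in which the decoder appears in [reading_test_kernels]. *)
Definition qform (T : finType) (c : T -> T -> C) (w : T -> C) : C :=
  \sum_a \sum_b w a * (w b)^* * c a b.

Lemma qform_ge0 (T : finType) (c : T -> T -> C) w : kpsd c -> 0 <= qform c w.
Proof.
move=> /(_ (fun t => (w t)^*)); congr (0 <= _).
by apply: eq_bigr => s _; apply: eq_bigr => t _; rewrite conjCK; ring.
Qed.

(** The right side minus the left side is the form at [w1 - w2]. *)
Lemma qform_parallelogram (T : finType) (c : T -> T -> C) w1 w2 : kpsd c ->
  qform c (fun a => w1 a + w2 a) <= 2 * qform c w1 + 2 * qform c w2.
Proof.
move=> pc; rewrite -subr_ge0.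
rewrite (_ : _ - _ = qform c (fun a => w1 a - w2 a)) ?qform_ge0 //.
rewrite /qform !mulr_sumr -big_split -sumrB; apply: eq_bigr => a _ /=.
rewrite !mulr_sumr -big_split -sumrB; apply: eq_bigr => b _ /=.
by rewrite rmorphB rmorphD; ring.
Qed.

Lemma qform_le_norm (T : finType) (c : T -> T -> C) w :
  kpsd (fun a b => (a == b)%:R - c a b) -> qform c w <= \sum_a w a * (w a)^*.
Proof.
move=> /(qform_ge0 w) q0; rewrite -subr_ge0; move: q0; congr (0 <= _).
rewrite /qform -sumrB; apply: eq_bigr => a _.
under eq_bigr do rewrite mulrBr; rewrite sumrB; congr (_ - _).
rewrite (bigD1 a) //= eqxx mulr1 big1 ?addr0 // => b /negPf.
by rewrite eq_sym => ->; rewrite mulr0.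
Qed.

(** By completeness of the columns of [u], their truncations to [P] give rank-one matrices summing
    to the projection onto [P]. *)
Lemma sum_qform_unitary (T : finType) (c u : T -> T -> C) (P : pred T) :
  (forall a b, \sum_k u a k * (u b k)^* = (a == b)%:R) ->
  \sum_k qform c (fun a => if P a then u a k else 0) = \sum_(a | P a) c a a.
Proof.
move=> uu; rewrite /qform exchange_big /= [RHS]big_mkcond; apply: eq_bigr => a _.
rewrite exchange_big /=; have [Pa|nPa] := boolP (P a); last first.
  by rewrite big1 // => b _; rewrite big1 // => k _; rewrite !mul0r.
rewrite (bigD1 a) //= [X in _ + X]big1 ?addr0 => [|b nab].
  by rewrite Pa -mulr_suml uu eqxx mul1r.
have [Pb|nPb] := boolP (P b); last by rewrite big1 // => k _; rewrite rmorph0 mulr0 mul0r.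
by rewrite -mulr_suml uu eq_sym (negPf nab) mul0r.
Qed.

(* Winter's argument: with w = Pw + (1-P)w, the parallelogram inequality replaces
   the gentle measurement lemma at the harmless cost of a factor 2. *)
Lemma typical_test_bound (T : finType) (c u : T -> T -> C) (lam : T -> C)
    (P Q : pred T) (tau : C) :
  kpsd c -> kpsd (fun a b => (a == b)%:R - c a b) ->
  (forall a b, \sum_k u a k * (u b k)^* = (a == b)%:R) ->
  (forall k, \sum_a u a k * (u a k)^* = 1) ->
  (forall k, 0 <= lam k) -> 0 <= tau -> (forall k, Q k -> lam k <= tau) ->
  \sum_a \sum_b (\sum_k lam k * (u a k * (u b k)^*)) * c a b <=
  \sum_(k | ~~ Q k) lam k
  + 2 * \sum_(a | ~~ P a) \sum_k lam k * (u a k * (u a k)^*)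
  + 2 * tau * \sum_(a | P a) c a a.
Proof.
move=> pc pc1 uu u1 lam0 tau0 Qtau.
have -> : \sum_a \sum_b (\sum_k lam k * (u a k * (u b k)^*)) * c a b =
          \sum_k lam k * qform c (u^~ k).
  rewrite /qform; under [RHS]eq_bigr do rewrite mulr_sumr.
  rewrite [RHS]exchange_big; apply: eq_bigr => a _ /=.
  under [RHS]eq_bigr do rewrite mulr_sumr.
  rewrite [RHS]exchange_big; apply: eq_bigr => b _ /=.
  by rewrite mulr_suml; apply: eq_bigr => k _ /=; ring.
rewrite -(sum_qform_unitary c P uu) [\sum_(k | ~~ Q k) _]big_mkcond /=.
rewrite [\sum_(a | ~~ P a) _]exchange_big /= !mulr_sumr -!big_split.
apply: ler_sum => k _ /=.
set wP := fun a => if P a then u a k else 0.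
set wN := fun a => if P a then 0 else u a k.
have gP0 := qform_ge0 wP pc.
have eN : \sum_a wN a * (wN a)^* = \sum_(a | ~~ P a) u a k * (u a k)^*.
  by rewrite [RHS]big_mkcond; apply: eq_bigr => a _; rewrite /wN; case: (P a); rewrite ?mul0r.
have gN := qform_le_norm wN pc1; rewrite {}eN in gN.
have n0 : 0 <= \sum_(a | ~~ P a) u a k * (u a k)^*.
  by apply: sumr_ge0 => a _; exact: mul_conjC_ge0.
rewrite -mulr_sumr; case: ifPn => [nQ|/negPn Qk]; last first.
  rewrite add0r.
  have /(ler_wpM2l (lam0 k)) : qform c (u^~ k) <= 2 * qform c wP + 2 * qform c wN.
    rewrite (_ : qform c _ = qform c (fun a => wP a + wN a)) ?qform_parallelogram //.
    apply: eq_bigr => a _; apply: eq_bigr => b _.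
    by rewrite /wP /wN; case: (P a); case: (P b); rewrite ?addr0 ?add0r.
  move=> /le_trans; apply; rewrite mulrDr addrC lerD //.
    by rewrite mulrCA -mulrA ler_wpM2l // ler_wpM2r // Qtau.
  by rewrite mulrCA ler_wpM2l // ler_wpM2l.
(* For [k] outside [Q] the test accepts a unit vector with value at most 1, so [lam k] is charged in
   full to the first sum. *)
apply: (@le_trans _ _ (lam k)).
  by rewrite -[leRHS]mulr1 ler_wpM2l // -[leRHS](u1 k); exact: (qform_le_norm (u^~ k)).
by rewrite -addrA lerDl addr_ge0 ?mulr_ge0.
Qed.

End Kernels.

(** * Products over histories *)

(** Nested pairs with the latest call outermost, so that recursion on [k] follows the recursion of
    [adaptive_run]. *)
Fixpoint hist (J : finType) (k : nat) : finType :=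
  if k is k'.+1 then (hist J k' * J)%type else unit.

Fixpoint hprod (V : pzSemiRingType) (J : finType) (f : nat -> J -> V) (k : nat) :
    hist J k -> V :=
  if k is k'.+1 then fun a => hprod f a.1 * f k' a.2 else fun=> 1.

Fixpoint hsum (V : nmodType) (J : finType) (f : nat -> J -> V) (k : nat) :
    hist J k -> V :=
  if k is k'.+1 then fun a => hsum f a.1 + f k' a.2 else fun=> 0.

Lemma sum_hist0 (V : nmodType) (J : finType) (F : hist J 0 -> V) :
  \sum_a F a = F tt.
Proof.
by rewrite (bigD1 tt) //= big1 ?addr0 // => -[]; rewrite eqxx.
Qed.

Lemma sum_histS (V : nmodType) (J : finType) k (F : hist J k.+1 -> V) :
  \sum_a F a = \sum_(a : hist J k) \sum_(j : J) F (a, j).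
Proof. by rewrite pair_bigA; apply: eq_bigr => -[]. Qed.

Lemma sum_hprod (V : comPzSemiRingType) (J : finType) (f : nat -> J -> V) k :
  \sum_(a : hist J k) hprod f a = \prod_(i < k) \sum_j f i j.
Proof.
elim: k => [|k IH]; first by rewrite sum_hist0 big_ord0.
rewrite sum_histS big_ord_recr /= -IH mulr_suml; apply: eq_bigr => a _.
by rewrite mulr_sumr.
Qed.

Lemma hprod_ge0 (V : numDomainType) (J : finType) (f : nat -> J -> V) k (a : hist J k) :
  (forall i j, 0 <= f i j) -> 0 <= hprod f a.
Proof. by move=> f0; elim: k a => [|k IH] a //=; rewrite mulr_ge0. Qed.

(** * Second moments and typicality for product distributions *)

Section HistoryMoments.
Variables (R : realType) (J : finType).
Implicit Types q lam Y : nat -> J -> R.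

Lemma sum_hprod1 q k : (forall i, \sum_j q i j = 1) ->
  \sum_(a : hist J k) hprod q a = 1.
Proof. by move=> q1; rewrite sum_hprod big1. Qed.

(** The coordinates are independent under [hprod q], so variances add up; each is then enlarged to
    the second moment. *)
Lemma hsum_variance q Y k : (forall i, \sum_j q i j = 1) ->
  \sum_(a : hist J k)
     hprod q a * (hsum Y a - \sum_(i < k) \sum_j q i j * Y i j) ^+ 2 <=
  \sum_(i < k) \sum_j q i j * Y i j ^+ 2.
Proof.
move=> q1; elim: k => [|k IH].
  by rewrite sum_hist0 !big_ord0 subr0 expr0n mulr0.
rewrite sum_histS !big_ord_recr /=.
set M := \sum_(i < k) \sum_j q i j * Y i j in IH *; set m := \sum_j q k j * Y k j.
have -> : \sum_(a : hist J k) \sum_j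
    hprod q a * q k j * (hsum Y a + Y k j - (M + m)) ^+ 2 =
  \sum_(a : hist J k) hprod q a * (hsum Y a - M) ^+ 2 +
  (\sum_j q k j * Y k j ^+ 2 - m ^+ 2).
  transitivity (\sum_(a : hist J k) (hprod q a * (hsum Y a - M) ^+ 2 +
     (hprod q a * (\sum_j q k j * Y k j ^+ 2 - m ^+ 2)))); last first.
    by rewrite big_split /= -mulr_suml sum_hprod1 // mul1r.
  apply: eq_bigr => a _; set s := hsum Y a.
  transitivity (\sum_j (hprod q a * (s - M - m) ^+ 2 * q k j +
     2 * hprod q a * (s - M - m) * (q k j * Y k j) +
     hprod q a * (q k j * Y k j ^+ 2))); first by apply: eq_bigr => j _; ring.
  by rewrite !big_split /= -!mulr_sumr q1 -/m; ring.
by rewrite lerD // gerDl oppr_le0 sqr_ge0.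
Qed.

Lemma hsum_chebyshev q Y k (t : R) : (forall i, \sum_j q i j = 1) ->
  (forall i j, 0 <= q i j) -> 0 < t ->
  \sum_(a : hist J k | t <= `|hsum Y a - \sum_(i < k) \sum_j q i j * Y i j|)
    hprod q a <= (\sum_(i < k) \sum_j q i j * Y i j ^+ 2) / t ^+ 2.
Proof.
move=> q1 q0 t0; rewrite ler_pdivlMr ?exprn_gt0 // mulr_suml.
apply: le_trans (hsum_variance Y k q1); rewrite big_mkcond; apply: ler_sum => a _.
case: ifP => [ta|_]; last by rewrite mulr_ge0 ?sqr_ge0 ?hprod_ge0.
rewrite ler_wpM2l ?hprod_ge0 // -[leRHS]real_normK ?num_real //.
by rewrite ler_pXn2r // nnegrE ?normr_ge0 ?(ltW t0).
Qed.

(** A history of nonzero [q]-weight avoids the zeros of [lam], where [ln] only has a default value,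
    so the logarithm of the product splits. *)
Lemma hprod_neq0_ln q lam k (a : hist J k) : (forall i j, 0 <= lam i j) ->
  (forall i j, (i < k)%N -> lam i j = 0 -> q i j = 0) -> hprod q a != 0 ->
  0 < hprod lam a /\ hsum (fun i j => - ln (lam i j)) a = - ln (hprod lam a).
Proof.
move=> lam0; elim: k a => [|k IH] a supp /=; first by rewrite ln1 oppr0 ltr01.
rewrite mulf_eq0 negb_or => /andP[qa qk].
have [|la ->] := IH a.1 _ qa; first by move=> i j ik; apply: supp; apply: ltnW.
have lk : 0 < lam k a.2.
  rewrite lt_neqAle lam0 andbT; apply: contra qk => /eqP lk0.
  by rewrite (supp k).
by rewrite mulr_gt0 // lnM ?posrE // opprD.
Qed.

(** Chebyshev for [- ln lam] along a history drawn from [q]. The two families may differ: with [q]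
    equal to [lam] it treats the spectrum of a codeword state, and with [q] the diagonal of that
    state in the eigenbasis of the average state it treats the spectrum of the latter. *)
Lemma atypical_prob q lam k (t : R) (P : pred (hist J k)) :
  (forall i, \sum_j q i j = 1) -> (forall i j, 0 <= q i j) ->
  (forall i j, 0 <= lam i j) ->
  (forall i j, (i < k)%N -> lam i j = 0 -> q i j = 0) -> 0 < t ->
  (forall a, 0 < hprod lam a ->
     `|- ln (hprod lam a) - \sum_(i < k) \sum_j q i j * - ln (lam i j)| < t -> P a) ->
  \sum_(a : hist J k | ~~ P a) hprod q a <=
  (\sum_(i < k) \sum_j q i j * ln (lam i j) ^+ 2) / t ^+ 2.
Proof.
move=> q1 q0 lam0 supp t0 tP.
under [in leRHS]eq_bigr do under eq_bigr do rewrite -sqrrN.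
apply: le_trans (hsum_chebyshev (fun i j => - ln (lam i j)) k q1 q0 t0).
rewrite big_mkcond [leRHS]big_mkcond; apply: ler_sum => a _ /=.
case: ifP => [nPa|_]; last by case: ifP; rewrite ?hprod_ge0.
case: ifPn => //; rewrite -ltNge.
have [->//|qa] := eqVneq (hprod q a) 0.
have [la -> lt] := hprod_neq0_ln lam0 supp qa.
by rewrite (tP a) in nPa.
Qed.

End HistoryMoments.

(** With [s] the square root of [t], the left side is [4 * (s * ln s) ^+ 2], and
    [ln s^-1 <= s^-1 - 1] gives [- (s * ln s) <= 1]. This makes the variance bounds uniform over all
    spectra. *)
Lemma mul_ln_sqr_le4 (R : realType) (t : R) : 0 <= t <= 1 -> t * ln t ^+ 2 <= 4.
Proof.
move=> /andP[t0 t1]; have [->|tn0] := eqVneq t 0; first by rewrite mul0r.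
have tp : 0 < t by rewrite lt_neqAle eq_sym tn0.
set s := Num.sqrt t; have sp : 0 < s by rewrite sqrtr_gt0.
have ts : t = s ^+ 2 by rewrite sqr_sqrtr.
have s1 : s <= 1 by rewrite /s -sqrtr1 ler_wsqrtr.
rewrite {1}ts {1}ts lnXn // -mulr_natl.
have l0 : ln s <= 0 by rewrite ln_le0.
have l1 : - (s * ln s) <= 1.
  have : ln (s^-1) <= s^-1 - 1.
    by have := expR_ge1Dx (ln s^-1); rewrite lnK ?posrE ?invr_gt0 //; lra.
  rewrite lnV ?posrE // => /(ler_wpM2l (ltW sp)); rewrite mulrBr divff ?gt_eqF //.
  rewrite mulrN mulr1; lra.
have : (s * ln s) ^+ 2 <= 1 ^+ 2.
  by rewrite -sqrrN lerXn2r ?nnegrE // oppr_ge0 mulr_ge0_le0 // ltW.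
by rewrite !exprMn expr1n; nra.
Qed.

(** * Channels on kernels *)

Section HermitianKernels.
Variable C : numClosedFieldType.

(** Polarization: the form is real at the test vectors (1, 1) and (1, i) supported on [s] and [t].
    Pulling back to [bool] also covers the case where [s] and [t] coincide. *)
Lemma kpsd_conj (T : finType) (K : T -> T -> C) s t : kpsd K -> (K s t)^* = K t s.
Proof.
move=> pK; pose h (x : bool) := if x then s else t.
have pos w := kpsd_comp h pK w.
have real x y : (x^* * y * K s t + y^* * x * K t s)^* =
    x^* * y * K s t + y^* * x * K t s.
  have r1 : (K s s)^* = K s s by have /ger0_real/CrealP := kpsd_diag_ge0 s pK.
  have r2 : (K t t)^* = K t t by have /ger0_real/CrealP := kpsd_diag_ge0 t pK.
  have := pos (fun b => if b then x else y); rewrite !big_bool /=.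
  move=> /ger0_real/CrealP; rewrite !rmorphD !rmorphM /= !conjCK r1 r2 => e.
  apply/eqP; rewrite -subr_eq0.
  by move/eqP: e; rewrite -subr_eq0 => /eqP e; apply/eqP; rewrite -[RHS]e; ring.
have := real 1 'i; have := real 1 1.
rewrite /= !rmorphD !rmorphM /= !conjCK !conjCi !rmorph1 !mul1r !mulr1 => e1.
move=> e2.
have {e2} /(mulfI (neq0Ci _)) e2 : 'i * ((K t s)^* - (K s t)^*) = 'i * (K s t - K t s).
  transitivity (- 'i * (K s t)^* + 'i * (K t s)^*); first by ring.
  by rewrite e2; ring.
have : 2 * (K s t)^* = 2 * K t s.
  have -> : 2 * (K s t)^* = ((K s t)^* + (K t s)^*) - ((K t s)^* - (K s t)^*) by ring.
  by rewrite e1 e2; ring.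
by move/mulfI; apply; rewrite pnatr_eq0.
Qed.
End HermitianKernels.

Section Channels.
Variable R : rcfType.
Local Notation C := R[i].

Lemma psdmx_kpsd n (M : 'M[C]_n) : psdmx M <-> kpsd M.
Proof.
have qE (v : 'cV[C]_n) :
    (dagger v *m M *m v) 0 0 = \sum_s \sum_t (v s 0)^* * M s t * v t 0.
  rewrite mxE exchange_big; apply: eq_bigr => t _; rewrite mxE mulr_suml.
  by apply: eq_bigr => s _; rewrite !mxE.
split=> [[_ pM] w|pM].
  have := pM (\col_i w i); rewrite qE; congr (0 <= _).
  by apply: eq_bigr => s _; apply: eq_bigr => t _; rewrite !mxE.
split; last by move=> v; rewrite qE; exact: pM.
by apply/matrixP => s t; rewrite !mxE; exact: kpsd_conj.
Qed.

Definition mxblk a b (X : 'M[C]_(a * b)) (i j : 'I_a) : 'M[C]_b :=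
  \matrix_(s, t) X (mxtens_index (i, s)) (mxtens_index (j, t)).

Lemma mxtensP a b (X Y : 'M[C]_(a * b)) :
  (forall i s j t, X (mxtens_index (i, s)) (mxtens_index (j, t)) =
                   Y (mxtens_index (i, s)) (mxtens_index (j, t))) -> X = Y.
Proof.
move=> eXY; apply/matrixP => x y.
rewrite -(mxtens_unindexK x) -(mxtens_unindexK y).
by case: (mxtens_unindex x) (mxtens_unindex y) => i s [j t].
Qed.

Lemma idtensE k n m (Phi : 'M[C]_n -> 'M[C]_m) X (a b : 'I_k) i j :
  idtens k Phi X (mxtens_index (a, i)) (mxtens_index (b, j)) =
  Phi (mxblk X a b) i j.
Proof.
rewrite /idtens summxE (bigD1 a) //= [X in _ + X]big1 ?addr0 => [|a' na].
  rewrite summxE (bigD1 b) //= [X in _ + X]big1 ?addr0 => [|b' nb].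
    by rewrite tensmxE mxE !eqxx mul1r.
  by rewrite tensmxE mxE [b == _]eq_sym (negPf nb) andbF mul0r.
rewrite summxE big1 // => b' _.
by rewrite tensmxE mxE [a == _]eq_sym (negPf na) mul0r.
Qed.

Lemma channel_sum n m (Phi : 'M[C]_n -> 'M[C]_m) (I : finType) (c : I -> C) X :
  is_channel Phi -> Phi (\sum_i c i *: X i) = \sum_i c i *: Phi (X i).
Proof.
case=> lin _ _; elim/big_rec2: _ => [|i y1 y2 _ <-]; last exact: lin.
have := lin 1 0 0; rewrite !scale1r addr0 => e.
by apply: (addrI (Phi 0)); rewrite -e addr0.
Qed.

(** Complete positivity for block matrices whose blocks are indexed by any finite type, obtained by
    flattening [I] through its enumeration. *)
Lemma channel_kpsd n m (Phi : 'M[C]_n -> 'M[C]_m) (I : finType)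
    (B : I -> I -> 'M[C]_n) : is_channel Phi ->
  kpsd (fun p q : I * 'I_n => B p.1 q.1 p.2 q.2) ->
  kpsd (fun p q : I * 'I_m => Phi (B p.1 q.1) p.2 q.2).
Proof.
move=> [_ _ cp] pB.
pose X : 'M[C]_(#|I| * n) := \matrix_(s, t)
  B (enum_val (mxtens_unindex s).1) (enum_val (mxtens_unindex t).1)
    (mxtens_unindex s).2 (mxtens_unindex t).2.
have /cp/psdmx_kpsd : psdmx X.
  apply/psdmx_kpsd; apply: (eq_kpsd _ (kpsd_comp
    (fun s : 'I_(#|I| * n) => (enum_val (mxtens_unindex s).1, (mxtens_unindex s).2)) pB)).
  by move=> s t; rewrite mxE.
move=> /(kpsd_comp (fun p : I * 'I_m => mxtens_index (enum_rank p.1, p.2))).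
apply: eq_kpsd => -[a i] [b j]; rewrite idtensE /=; congr (Phi _ i j).
by apply/matrixP => s t; rewrite !mxE !mxtens_indexK !enum_rankK.
Qed.

Lemma mxtrace_mxblk a b (X : 'M[C]_(a * b)) : \tr X = \sum_i \tr (mxblk X i i).
Proof.
rewrite /mxtrace pair_bigA (reindex (@mxtens_index a b)) /=; last first.
  by exists (@mxtens_unindex a b) => x _; rewrite (mxtens_indexK, mxtens_unindexK).
by apply: eq_bigr => -[i s] _; rewrite mxE.
Qed.

Lemma mxtrace_tens a b (X : 'M[C]_a) (Y : 'M[C]_b) : \tr (X *t Y) = \tr X * \tr Y.
Proof.
rewrite mxtrace_mxblk mulr_suml; apply: eq_bigr => i _.
by rewrite mulr_sumr; apply: eq_bigr => s _; rewrite mxE tensmxE.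
Qed.

End Channels.

(** * Spectral decomposition of positive semidefinite matrices *)

Section PsdSpectral.
Variable R : rcfType.
Local Notation C := R[i].
Local Notation "r %:C" := (real_complex R r).

Definition eigval n (M : 'M[C]_n) (k : 'I_n) : R := complex.Re (spectral_diag M 0 k).

Lemma psd_spectral n (M : 'M[C]_n) : psdmx M ->
  exists U : 'I_n -> 'I_n -> C,
  [/\ forall k, 0 <= eigval M k,
      forall a b, \sum_k U a k * (U b k)^* = (a == b)%:R,
      forall k l, \sum_a (U a k)^* * U a l = (k == l)%:R &
      forall a b, M a b = \sum_k (eigval M k)%:C * (U a k * (U b k)^*)].
Proof.
move=> pM; have nM : M \is normalmx.
  case: pM => [hM _]; apply/normalmxP.
  by move: hM; rewrite /dagger => ->.
have /orthomx_spectralP := nM.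
rewrite invmx_unitary ?spectral_unitarymx //.
set W := spectralmx M; set d := spectral_diag M => eM.
have /unitarymxP uW : W \is unitarymx by exact: spectral_unitarymx.
have /unitarymxP uW' : (W ^t*)%sesqui \is unitarymx.
  by rewrite trmxC_unitary; exact: spectral_unitarymx.
rewrite trmxCK in uW'.
have ME a b : M a b = \sum_k d 0 k * ((W k a)^* * W k b).
  rewrite eM mul_mx_diag mxE; apply: eq_bigr => k _; rewrite !mxE; ring.
have row k l : \sum_a W k a * (W l a)^* = (k == l)%:R.
  have := congr1 (fun X : 'M_n => X k l) uW; rewrite !mxE => <-.
  by apply: eq_bigr => a _; rewrite !mxE.
have col a b : \sum_k (W k a)^* * W k b = (a == b)%:R.
  have := congr1 (fun X : 'M_n => X a b) uW'; rewrite !mxE => <-.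
  by apply: eq_bigr => k _; rewrite !mxE.
(* Testing positivity on the [k]-th eigenvector isolates the [k]-th eigenvalue. *)
have d0 k : 0 <= d 0 k.
  have /psdmx_kpsd/(_ (fun a => (W k a)^*)) := pM; congr (0 <= _).
  transitivity (\sum_l d 0 l * ((\sum_a W k a * (W l a)^*) * (\sum_b W l b * (W k b)^*))).
    under [RHS]eq_bigr do rewrite mulr_suml mulr_sumr.
    rewrite [RHS]exchange_big; apply: eq_bigr => a _ /=.
    under [RHS]eq_bigr do rewrite mulr_sumr mulr_sumr.
    rewrite [RHS]exchange_big; apply: eq_bigr => b _ /=.
    rewrite ME conjCK mulr_sumr mulr_suml; apply: eq_bigr => l _; ring.
  rewrite (bigD1 k) //= !row eqxx !mulr1 big1 ?addr0 // => l nl.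
  by rewrite row [k == l]eq_sym (negPf nl) mul0r mulr0.
exists (fun a k => (W k a)^*); split=> //.
- by move=> k; move: (d0 k); rewrite /eigval -/d lecE => /andP[].
- by move=> a b; rewrite -col; apply: eq_bigr => k _; rewrite conjCK.
- by move=> k l; rewrite -row; apply: eq_bigr => a _; rewrite conjCK.
move=> a b; rewrite ME; apply: eq_bigr => k _.
by rewrite conjCK /eigval RRe_real // ger0_real.
Qed.

(** The spectral decomposition of [L] writes the trace as a sum over [k] of congruences of [B], with
    the eigenvector scaled by the square root of its eigenvalue and placed in block [a]. *)
Lemma kpsd_mxtrace_mul n (L : 'M[C]_n) (I : finType) (B : I -> I -> 'M[C]_n) :
  psdmx L -> kpsd (fun p q : I * 'I_n => B p.1 q.1 p.2 q.2) ->
  kpsd (fun a b => \tr (L *m B a b)).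
Proof.
move=> /psd_spectral[U []]; set lam := eigval L => lam0 _ _ eL pB.
pose h k (a : I) (p : I * 'I_n) : C :=
  if p.1 == a then sqrtC (lam k)%:C * U p.2 k else 0.
have hs k : kpsd (fun a b => \sum_p \sum_q (h k a p)^* * B p.1 q.1 p.2 q.2 * h k b q).
  exact: (kpsd_sum_fst _ pB).
apply: (eq_kpsd _ (kpsd_sum hs)) => a b.
have hE k : \sum_p \sum_q (h k a p)^* * B p.1 q.1 p.2 q.2 * h k b q =
    \sum_x \sum_y (lam k)%:C * (U y k * (U x k)^*) * B a b x y.
  rewrite -(pair_bigA _ (fun c x => \sum_q (h k a (c, x))^* * B c q.1 x q.2 * h k b q)).
  rewrite (bigD1 a) //= [X in _ + X]big1 ?addr0 => [|c nc]; last first.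
    rewrite big1 // => x _; rewrite big1 // => q _.
    by rewrite /h /= (negPf nc) rmorph0 !mul0r.
  apply: eq_bigr => x _.
  rewrite -(pair_bigA _ (fun c y => (h k a (a, x))^* * B a c x y * h k b (c, y))).
  rewrite (bigD1 b) //= [X in _ + X]big1 ?addr0 => [|c nc]; last first.
    by rewrite big1 // => y _; rewrite /h /= (negPf nc) mulr0.
  apply: eq_bigr => y _; rewrite /h /= !eqxx rmorphM.
  have s0 : 0 <= sqrtC (lam k)%:C by rewrite sqrtC_ge0 ler0c.
  have /CrealP /= -> := ger0_real s0.
  by rewrite -[in RHS](sqrtCK (lam k)%:C); ring.
under eq_bigr do rewrite hE.
rewrite /mxtrace exchange_big /=.
under eq_bigr do rewrite exchange_big /=.
rewrite exchange_big; apply: eq_bigr => y _ /=.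
rewrite mxE; apply: eq_bigr => x _; rewrite eL mulr_suml.
by apply: eq_bigr.
Qed.

Lemma sum_eigval n (M : 'M[C]_n) : density M -> \sum_k eigval M k = 1.
Proof.
move=> [/psd_spectral[U [_ _ oU eM]] tr1]; apply: (@complexI R).
rewrite rmorph_sum rmorph1 -tr1 /mxtrace.
under [RHS]eq_bigr do rewrite eM.
rewrite exchange_big; apply: eq_bigr => k _ /=; rewrite -mulr_sumr.
by under eq_bigr do rewrite mulrC; rewrite oU eqxx mulr1.
Qed.

Lemma eigval_le1 n (M : 'M[C]_n) k : density M -> 0 <= eigval M k <= 1.
Proof.
move=> dM; have [/psd_spectral[U [e0 _ _ _]] _] := dM; rewrite e0 -(sum_eigval dM).
by rewrite (bigD1 k) //= lerDl sumr_ge0.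
Qed.

Lemma density_mixture (X : finType) n (theta : X -> 'M[C]_n) (p : X -> R) :
  (forall x, 0 <= p x) -> \sum_x p x = 1 -> (forall x, density (theta x)) ->
  density (\sum_x (p x)%:C *: theta x).
Proof.
move=> p0 p1 dth; split; last first.
  rewrite raddf_sum -[RHS](rmorph1 (real_complex R)) -p1 rmorph_sum.
  by apply: eq_bigr => x _; rewrite /= mxtraceZ; case: (dth x) => _ ->; rewrite mulr1.
apply/psdmx_kpsd.
have: kpsd (fun s t => \sum_x (p x)%:C * theta x s t).
  apply: kpsd_sum => x w; have [/psdmx_kpsd/(_ w) h _] := dth x.
  have : 0 <= (p x)%:C * \sum_s \sum_t (w s)^* * theta x s t * w t.
    by rewrite mulr_ge0 // ler0c.
  congr (0 <= _); rewrite mulr_sumr; apply: eq_bigr => s _.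
  by rewrite mulr_sumr; apply: eq_bigr => t _; ring.
by apply: eq_kpsd => s t; rewrite summxE; apply: eq_bigr => x _; rewrite mxE.
Qed.

End PsdSpectral.

(** * Simulation by environment states *)

Section HistoryProducts.
Variable (J : finType).

(** The entries of the tensor product of the matrices [t 0], ..., [t k.-1]. *)
Fixpoint hprod2 (V : pzSemiRingType) (t : nat -> J -> J -> V) (k : nat) :
    hist J k -> hist J k -> V :=
  if k is k'.+1 then fun a b => hprod2 t a.1 b.1 * t k' a.2 b.2 else fun _ _ => 1.

(** Distributivity: spectral decompositions of the factors combine into one of the tensor product,
    with product eigenvalues and product eigenvectors. *)
Lemma hprod2_sum (V : comPzSemiRingType) (lam : nat -> J -> V) (u v : nat -> J -> J -> V) k
    (a b : hist J k) :
  hprod2 (fun i x y => \sum_z lam i z * (u i x z * v i y z)) a b =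
  \sum_c hprod lam c * (hprod2 u a c * hprod2 v b c).
Proof.
elim: k a b => [|k IH] a b /=; first by rewrite (@sum_hist0 _ J) !mulr1.
rewrite sum_histS IH mulr_suml; apply: eq_bigr => c _.
by rewrite mulr_sumr; apply: eq_bigr => z _ /=; ring.
Qed.

Lemma eq_hprod2 (V : pzSemiRingType) (t t' : nat -> J -> J -> V) k (a b : hist J k) :
  (forall i x y, t i x y = t' i x y) -> hprod2 t a b = hprod2 t' a b.
Proof. by move=> e; elim: k a b => [|k IH] a b //=; rewrite IH e. Qed.

Lemma hprod2_diag (V : pzSemiRingType) (t : nat -> J -> J -> V) k (a : hist J k) :
  hprod2 t a a = hprod (fun i x => t i x x) a.
Proof. by elim: k a => [|k IH] a //=; rewrite IH. Qed.

Lemma hprod2_delta (V : pzSemiRingType) k (a b : hist J k) :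
  hprod2 (fun _ x y => (x == y)%:R : V) a b = (a == b)%:R.
Proof.
elim: k a b => [|k IH] /= => [[] []|[a x] [b y]] //=.
by rewrite IH xpair_eqE; case: (a == b); rewrite ?mul1r ?mul0r.
Qed.

Lemma hprod2_conj (C : numClosedFieldType) (t : nat -> J -> J -> C) k (a b : hist J k) :
  (hprod2 t a b)^* = hprod2 (fun i x y => (t i x y)^*) a b.
Proof. by elim: k a b => [|k IH] a b /=; rewrite ?rmorph1 // rmorphM /= IH. Qed.

Lemma hprod2_tr (V : pzSemiRingType) (t : nat -> J -> J -> V) k (a b : hist J k) :
  hprod2 (fun i x y => t i y x) a b = hprod2 t b a.
Proof. by elim: k a b => [|k IH] a b //=; rewrite IH. Qed.

Lemma hprod2_unitary (C : numClosedFieldType) (u : nat -> J -> J -> C) k (a b : hist J k) :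
  (forall i x y, \sum_z u i x z * (u i y z)^* = (x == y)%:R) ->
  \sum_c hprod2 u a c * (hprod2 u b c)^* = (a == b)%:R.
Proof.
move=> uu; rewrite -hprod2_delta.
transitivity (hprod2 (fun i x y => \sum_z 1 * (u i x z * (u i y z)^*)) a b); last first.
  by apply: eq_hprod2 => i x y; rewrite -(uu i); apply: eq_bigr => z _; rewrite mul1r.
rewrite (hprod2_sum (fun _ _ => 1) u (fun i x y => (u i x y)^*)).
apply: eq_bigr => c _; rewrite hprod2_conj.
have -> : hprod (fun _ _ => 1 : C) c = 1.
  by elim: k {a b} c => [|k IH] c //=; rewrite IH mulr1.
by rewrite mul1r.
Qed.

End HistoryProducts.

(* Teleportation-type simulation: the output of n calls is a completely positive image
   of the n-fold tensor product of environment states, with [rank1mx S j l] standing for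
   the operator |psi_j><psi_l| in an orthonormal basis psi of the environment. *)
Section Simulation.
Variables (R : rcfType) (dA dB dE : nat).
Local Notation C := R[i].
Local Notation J := 'I_dE.
Variables (F : 'M[C]_(dA * dE) -> 'M[C]_dB) (S : J -> J -> C).
Hypothesis F_channel : is_channel F.
Hypothesis S_orthonormal : forall j l, \sum_e (S e j)^* * S e l = (j == l)%:R.

Definition rank1mx (j l : J) : 'M[C]_dE := \matrix_(e, e') (S e j * (S e' l)^*).

(** The environment slot accepts any matrix, not only a state, so that a call is bilinear and can be
    expanded in the operators [rank1mx S j l]. *)
Definition env_call r (X : 'M[C]_(r * dA)) (tau : 'M[C]_dE) : 'M[C]_(r * dB) :=
  idtens r (fun rho => F (rho *t tau)) X.

Lemma env_call_sum r (I I' : finType) (c : I -> C) X (d : I' -> C) tau :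
  env_call (\sum_i c i *: X i : 'M_(r * dA)) (\sum_j d j *: tau j) =
  \sum_i \sum_j (c i * d j) *: env_call (X i) (tau j).
Proof.
apply: mxtensP => p s q t; rewrite idtensE.
have -> : mxblk (\sum_i c i *: X i : 'M_(r * dA)) p q *t (\sum_j d j *: tau j) =
    \sum_(ij : I * I') (c ij.1 * d ij.2) *: (mxblk (X ij.1) p q *t tau ij.2).
  apply: mxtensP => x e y e'; rewrite tensmxE mxE !summxE mulr_suml.
  rewrite -(pair_bigA _ (fun i j => ((c i * d j) *: (mxblk (X i) p q *t tau j))
                (mxtens_index (x, e)) (mxtens_index (y, e')))).
  apply: eq_bigr => i _; rewrite mulr_sumr; apply: eq_bigr => j _.
  by rewrite !(mxE, mxtens_indexK) /=; ring.
rewrite channel_sum // !summxE.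
rewrite -(pair_bigA _ (fun i j => ((c i * d j) *: F (mxblk (X i) p q *t tau j)) s t)).
apply: eq_bigr => i _; rewrite summxE; apply: eq_bigr => j _.
by rewrite !mxE idtensE.
Qed.

Lemma mxtrace_env_call r (X : 'M[C]_(r * dA)) j l :
  \tr (env_call X (rank1mx j l)) = \tr X * (j == l)%:R.
Proof.
have tE : \tr (rank1mx j l) = (j == l)%:R.
  rewrite eq_sym -S_orthonormal; apply: eq_bigr => e _.
  by rewrite mxE mulrC.
rewrite -tE mxtrace_mxblk [\tr X]mxtrace_mxblk mulr_suml; apply: eq_bigr => i _.
case: F_channel => _ tp _; rewrite -mxtrace_tens -tp.
by congr (\tr _); apply/matrixP => s t; rewrite mxE idtensE.
Qed.

(** Tensoring the blocks of [B] with [rank1mx] is, up to reindexing, an entrywise product with a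
    rank-one kernel; [F] then acts blockwise by [channel_kpsd]. *)
Lemma env_call_kpsd r (I : finType) (B : I -> I -> 'M[C]_(r * dA)) :
  kpsd (fun p q : I * 'I_(r * dA) => B p.1 q.1 p.2 q.2) ->
  kpsd (fun p q : (I * J) * 'I_(r * dB) =>
     env_call (B p.1.1 q.1.1) (rank1mx p.1.2 q.1.2) p.2 q.2).
Proof.
move=> pB.
pose B' (p q : (I * J) * 'I_r) := mxblk (B p.1.1 q.1.1) p.2 q.2 *t rank1mx p.1.2 q.1.2.
have /(channel_kpsd F_channel) : kpsd (fun p q : (I * J * 'I_r) * 'I_(dA * dE) =>
    B' p.1 q.1 p.2 q.2).
  have := kpsd_mul_rank1 (fun p : (I * J * 'I_r) * 'I_(dA * dE) =>
      S (mxtens_unindex p.2).2 p.1.1.2)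
    (kpsd_comp (fun p : (I * J * 'I_r) * 'I_(dA * dE) =>
      (p.1.1.1, mxtens_index (p.1.2, (mxtens_unindex p.2).1))) pB).
  by apply: eq_kpsd => p q; rewrite !mxE.
move=> /(kpsd_comp (fun p : (I * J) * 'I_(r * dB) =>
  ((p.1, (mxtens_unindex p.2).1), (mxtens_unindex p.2).2))).
apply: eq_kpsd => -[[a j] x] [[b l] y] /=.
rewrite -[x in RHS]mxtens_unindexK -[y in RHS]mxtens_unindexK.
by rewrite idtensE.
Qed.

Variables (dR : nat -> nat) (rho1 : 'M[C]_(dR 0 * dA)).
Variable Ad : forall k, 'M[C]_(dR k * dB) -> 'M[C]_(dR k.+1 * dA).

(** The histories [a] and [b] list the ket and bra indices of the operators fed into the environment
    slots of the calls made so far. *)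
Fixpoint kernel_in (k : nat) : hist J k -> hist J k -> 'M[C]_(dR k * dA) :=
  match k return hist J k -> hist J k -> 'M[C]_(dR k * dA) with
  | 0 => fun _ _ => rho1
  | k'.+1 => fun a b => Ad (env_call (kernel_in a.1 b.1) (rank1mx a.2 b.2))
  end.

Definition kernel_out k (a b : hist J k.+1) : 'M[C]_(dR k * dB) :=
  env_call (kernel_in a.1 b.1) (rank1mx a.2 b.2).

Lemma kernel_in_kpsd k : density rho1 -> (forall j, (j < k)%N -> is_channel (@Ad j)) ->
  kpsd (fun p q : hist J k * 'I_(dR k * dA) => kernel_in p.1 q.1 p.2 q.2).
Proof.
move=> [/psdmx_kpsd prho _]; elim: k => [|k IH] chA; first exact: kpsd_comp snd _ prho.
have /env_call_kpsd := IH (fun j lt => chA j (ltnW lt)).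
exact: (@channel_kpsd _ _ _ _ (hist J k.+1)
  (fun a b => env_call (kernel_in a.1 b.1) (rank1mx a.2 b.2)) (chA k (ltnSn k))).
Qed.

Lemma mxtrace_kernel_in k a b : \tr rho1 = 1 ->
  (forall j, (j < k)%N -> is_channel (@Ad j)) ->
  \tr (@kernel_in k a b) = (a == b)%:R.
Proof.
move=> tr1; elim: k a b => [[] []|k IH [a x] [b y]] chA; first by rewrite tr1.
case: (chA k (ltnSn k)) => _ /= -> _; rewrite mxtrace_env_call IH => [|j jk].
  by rewrite xpair_eqE -natrM mulnb.
exact/chA/ltnW.
Qed.

(** The whole run is multilinear in the environment matrices. With [id] as the family of states, the
    letters of the cell are these matrices themselves. *)
Lemma adaptive_run_kernel (t : nat -> J -> J -> C) tau k :
  (forall i, tau i = \sum_(p : J * J) t i p.1 p.2 *: rank1mx p.1 p.2) ->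
  (forall j, (j < k)%N -> is_channel (@Ad j)) ->
  adaptive_run (env_memory_cell F id) rho1 Ad tau k =
  \sum_(q : hist J k.+1 * hist J k.+1) hprod2 t q.1 q.2 *: kernel_out q.1 q.2.
Proof.
move=> tE.
have step n (X : 'M[C]_(dR n * dA)) :
  X = \sum_(q : hist J n * hist J n) hprod2 t q.1 q.2 *: kernel_in q.1 q.2 ->
  env_call X (tau n) =
  \sum_(q : hist J n.+1 * hist J n.+1) hprod2 t q.1 q.2 *: kernel_out q.1 q.2.
  move=> ->; rewrite tE env_call_sum pair_bigA /=.
  rewrite (reindex (fun q : hist J n.+1 * hist J n.+1 =>
     ((q.1.1, q.2.1), (q.1.2, q.2.2)))) //=.
  exists (fun q : (hist J n * hist J n) * (J * J) =>
     ((q.1.1, q.2.1), (q.1.2, q.2.2))).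
  - by move=> [[? ?] [? ?]].
  - by move=> [[? ?] [? ?]].
elim: k => [|k IH] chA.
  apply: step; rewrite -(pair_bigA _ (fun a b => hprod2 t a b *: @kernel_in 0 a b)).
  by rewrite !sum_hist0 scale1r.
rewrite /= -/(env_call _ _); apply: step; rewrite IH => [|j jk]; last exact/chA/ltnW.
by rewrite channel_sum //; exact: chA.
Qed.

End Simulation.

(** Pulling the decoder back through the simulation gives a POVM on the environments of all [k.+1]
    calls. The kernels [c] are chosen before [t] and [tau], so a single POVM tests the environment
    product of every codeword. *)
Lemma reading_test_kernels (R : rcfType) (dA dB dE : nat)
    (F : 'M[R[i]]_(dA * dE) -> 'M[R[i]]_dB) (S : 'I_dE -> 'I_dE -> R[i])
    (dR : nat -> nat) (rho1 : 'M[R[i]]_(dR 0 * dA))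
    (Ad : forall k, 'M[R[i]]_(dR k * dB) -> 'M[R[i]]_(dR k.+1 * dA)) (k : nat)
    (I : finType) (Lam : I -> 'M[R[i]]_(dR k * dB)) :
  is_channel F -> (forall j l, \sum_e (S e j)^* * S e l = (j == l)%:R) ->
  density rho1 -> (forall j, (j < k)%N -> is_channel (Ad j)) -> is_povm Lam ->
  exists c : I -> hist 'I_dE k.+1 -> hist 'I_dE k.+1 -> R[i],
  [/\ forall m, kpsd (c m),
      forall a b, \sum_m c m a b = (a == b)%:R &
      forall (t : nat -> 'I_dE -> 'I_dE -> R[i]) (tau : nat -> 'M[R[i]]_dE),
        (forall i, tau i = \sum_(p : 'I_dE * 'I_dE) t i p.1 p.2 *: rank1mx S p.1 p.2) ->
        forall m, \tr (Lam m *m adaptive_run (env_memory_cell F id) rho1 Ad tau k) =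
          \sum_a \sum_b hprod2 t a b * c m a b].
Proof.
move=> chF oS drho chA [pL sL].
exists (fun m a b => \tr (Lam m *m kernel_out F S rho1 Ad a b)); split.
- move=> m; apply: kpsd_mxtrace_mul => //.
  have pout := env_call_kpsd S chF (kernel_in_kpsd S chF drho chA).
  exact: pout.
- move=> a b; rewrite -raddf_sum -mulmx_suml sL mul1mx /= mxtrace_env_call //.
  case: a b => a x [b y]; case: drho => _ tr1.
  by rewrite mxtrace_kernel_in // xpair_eqE -natrM mulnb.
move=> t tau tE m; rewrite (adaptive_run_kernel chF rho1 tE chA) mulmx_sumr raddf_sum.
rewrite [RHS]pair_bigA; apply: eq_bigr => q _.
by rewrite /= -scalemxAr mxtraceZ.
Qed.

(** * Single-type bound *)

Section EnsembleBasis.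
Variable R : realType.
Local Notation C := R[i].
Local Notation "r %:C" := (real_complex R r).

Lemma sum_deltal (J : finType) (f : J -> C) a : \sum_k (a == k)%:R * f k = f a.
Proof.
rewrite (bigD1 a) //= eqxx mul1r big1 ?addr0 // => k.
by rewrite eq_sym => /negPf ->; rewrite mul0r.
Qed.

Lemma orthonormal_rows_mul (J : finType) (A B : J -> J -> C) :
  (forall a b, \sum_k A a k * (A b k)^* = (a == b)%:R) ->
  (forall a b, \sum_k B a k * (B b k)^* = (a == b)%:R) ->
  forall a b, \sum_k (\sum_e A a e * B e k) * (\sum_e A b e * B e k)^* = (a == b)%:R.
Proof.
move=> rA rB a b; rewrite -rA.
under eq_bigr do rewrite rmorph_sum mulr_suml.
rewrite exchange_big; apply: eq_bigr => e _ /=.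
under eq_bigr do rewrite mulr_sumr.
rewrite exchange_big /=.
transitivity (\sum_f (e == f)%:R * (A a e * (A b f)^*)); last exact: sum_deltal.
apply: eq_bigr => f _; rewrite -rB mulr_suml; apply: eq_bigr => k _.
by rewrite rmorphM /=; ring.
Qed.

(* [S] is an eigenbasis of the average state, and [u x] expresses the eigenvectors of
   [theta x] in that basis; [q x] is the diagonal of [theta x] there. *)
Lemma ensemble_basis (X : finType) dE (theta : X -> 'M[C]_dE) (p : X -> R) :
  is_distr p -> (forall x, density (theta x)) ->
  exists (S : 'I_dE -> 'I_dE -> C) (u : X -> 'I_dE -> 'I_dE -> C) (q : X -> 'I_dE -> R),
  [/\ forall j l, \sum_e (S e j)^* * S e l = (j == l)%:R,
      forall x j l, \sum_k u x j k * (u x l k)^* = (j == l)%:R,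
      forall x k l, \sum_j u x j k * (u x j l)^* = (k == l)%:R &
      forall x, theta x = \sum_(jl : 'I_dE * 'I_dE)
        (\sum_k (eigval (theta x) k)%:C * (u x jl.1 k * (u x jl.2 k)^*)) *:
          rank1mx S jl.1 jl.2] /\
  [/\ forall x j, (q x j)%:C = \sum_k (eigval (theta x) k)%:C * (u x j k * (u x j k)^*),
      forall x j, 0 <= q x j, forall x, \sum_j q x j = 1 &
      forall j, \sum_x p x * q x j = eigval (\sum_x (p x)%:C *: theta x) j].
Proof.
move=> [p0 p1] dth.
have [/psd_spectral[S [_ rS cS eS]] _] := density_mixture p0 p1 dth.
set omega := \sum_x _ in eS *.
have /fin_all_exists[U HU] : forall x, exists U : 'I_dE -> 'I_dE -> C,
   [/\ forall k, 0 <= eigval (theta x) k,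
      forall a b, \sum_k U a k * (U b k)^* = (a == b)%:R,
      forall k l, \sum_a (U a k)^* * U a l = (k == l)%:R &
      forall a b, theta x a b = \sum_k (eigval (theta x) k)%:C * (U a k * (U b k)^*)].
  by move=> x; case: (dth x) => /psd_spectral.
pose u x j k := \sum_e (S e j)^* * U x e k.
have rSd j l : \sum_e (S e j)^* * ((S e l)^*)^* = (j == l)%:R.
  by rewrite -cS; apply: eq_bigr => e _; rewrite conjCK.
have cSd e f : \sum_j (S e j)^* * ((S f j)^*)^* = (e == f)%:R.
  by rewrite eq_sym -rS; apply: eq_bigr => j _; rewrite conjCK mulrC.
have Uu x e k : U x e k = \sum_j S e j * u x j k.
  under eq_bigr do rewrite mulr_sumr.
  rewrite exchange_big /= -[LHS](sum_deltal (fun f => U x f k)).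
  by apply: eq_bigr => f _; rewrite -rS mulr_suml; apply: eq_bigr => j _; rewrite mulrA.
have ru x j l : \sum_k u x j k * (u x l k)^* = (j == l)%:R.
  have [_ rU _ _] := HU x.
  exact: (orthonormal_rows_mul (A := fun j e => (S e j)^*) (B := U x)).
have cu x k l : \sum_j u x j k * (u x j l)^* = (k == l)%:R.
  have [_ _ cU _] := HU x.
  have rU a b : \sum_e U x e a * (U x e b)^* = (a == b)%:R.
    by rewrite eq_sym -cU; apply: eq_bigr => e _; rewrite mulrC.
  rewrite -(orthonormal_rows_mul (A := fun k e => U x e k) (B := fun e j => (S e j)^*) rU cSd).
  apply: eq_bigr => j _; congr (_ * _^*); apply: eq_bigr => e _; exact: mulrC.
pose q x j := complex.Re (\sum_k (eigval (theta x) k)%:C * (u x j k * (u x j k)^*)).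
have qc0 x j : 0 <= \sum_k (eigval (theta x) k)%:C * (u x j k * (u x j k)^*).
  have [e0 _ _ _] := HU x; apply: sumr_ge0 => k _.
  by rewrite mulr_ge0 ?mul_conjC_ge0 // ler0c.
have qE x j : (q x j)%:C = \sum_k (eigval (theta x) k)%:C * (u x j k * (u x j k)^*).
  by rewrite /q RRe_real // ger0_real.
exists S, u, q; split; split=> //.
- move=> x; have [_ _ _ eU] := HU x; apply/matrixP => e f; rewrite summxE eU.
  under [RHS]eq_bigr do rewrite !mxE mulr_suml.
  rewrite [RHS]exchange_big; apply: eq_bigr => k _ /=.
  rewrite !Uu rmorph_sum mulr_suml mulr_sumr.
  rewrite -[RHS](pair_bigA _ (fun j l => (eigval (theta x) k)%:C *
      (u x j k * (u x l k)^*) * (S e j * (S f l)^*))).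
  apply: eq_bigr => j _; rewrite mulr_sumr mulr_sumr; apply: eq_bigr => l _.
  by rewrite rmorphM /=; ring.
- by move=> x j; rewrite -ler0c qE.
- move=> x; apply: (@complexI R); rewrite rmorph_sum -(sum_eigval (dth x)) rmorph_sum /=.
  under eq_bigr do rewrite qE.
  rewrite exchange_big; apply: eq_bigr => k _ /=.
  by rewrite -mulr_sumr cu eqxx mulr1.
(* [q x j] is a diagonal entry of [theta x] in the basis [S]; it is therefore linear in [theta x]
   and averages to an eigenvalue of [omega]. *)
have diagE x j : (q x j)%:C = \sum_e \sum_f (S e j)^* * S f j * theta x e f.
  have [_ _ _ eU] := HU x; rewrite qE.
  under [RHS]eq_bigr do under eq_bigr do rewrite eU mulr_sumr.
  under [RHS]eq_bigr do rewrite exchange_big.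
  rewrite [RHS]exchange_big; apply: eq_bigr => k _ /=.
  rewrite [X in _ * (_ * X)]rmorph_sum mulr_suml mulr_sumr; apply: eq_bigr => e _.
  rewrite !mulr_sumr; apply: eq_bigr => f _.
  by rewrite rmorphM /= conjCK; ring.
move=> j; apply: (@complexI R); rewrite rmorph_sum.
transitivity (\sum_e \sum_f (S e j)^* * S f j * omega e f).
  under eq_bigr do rewrite rmorphM /= diagE mulr_sumr.
  rewrite exchange_big; apply: eq_bigr => e _ /=.
  under eq_bigr do rewrite mulr_sumr.
  rewrite exchange_big; apply: eq_bigr => f _ /=.
  rewrite /omega summxE mulr_sumr; apply: eq_bigr => x _.
  by rewrite mxE; ring.
transitivity (\sum_l (eigval omega l)%:C *
   ((\sum_e (S e j)^* * S e l) * (\sum_f (S f j)^* * S f l)^*)).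
  under eq_bigr do under eq_bigr do rewrite eS mulr_sumr.
  under eq_bigr do rewrite exchange_big.
  rewrite exchange_big; apply: eq_bigr => l _ /=.
  rewrite rmorph_sum mulr_suml mulr_sumr; apply: eq_bigr => e _.
  rewrite !mulr_sumr; apply: eq_bigr => f _.
  by rewrite rmorphM /= conjCK; ring.
under eq_bigr do rewrite !cS rmorph_nat mulrCA.
by rewrite (sum_deltal (fun l => (eigval omega l)%:C * (j == l)%:R)) eqxx mulr1.
Qed.

End EnsembleBasis.

Section TypeClassBound.
Variable R : realType.
Local Notation C := R[i].
Local Notation "r %:C" := (real_complex R r).

(** Von Neumann entropy in nats, matching the exponential estimates; bits return only in
    [qmutinf_cq_state]. *)
Definition nat_entropy n (M : 'M[C]_n) : R :=
  \sum_j eigval M j * - ln (eigval M j).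

Lemma hprod_real (J : finType) (f : nat -> J -> R) k (a : hist J k) :
  hprod (fun i j => (f i j)%:C) a = (hprod f a)%:C.
Proof. by elim: k a => [|k IH] a /=; rewrite ?rmorph1 // IH rmorphM. Qed.

Lemma eq_hprod (V : pzSemiRingType) (J : finType) (f g : nat -> J -> V) k (a : hist J k) :
  (forall i j, f i j = g i j) -> hprod f a = hprod g a.
Proof. by move=> e; elim: k a => [|k IH] a //=; rewrite IH e. Qed.

(** The hypothesis says that [p] is the type of the word, and a sum of letter functions depends on
    the word only through its type. *)
Lemma sum_type (X : finType) (xs : nat -> X) (n : nat) (p f : X -> R) :
  (forall x, (\sum_(i < n) (xs i == x))%:R = n%:R * p x) ->
  \sum_(i < n) f (xs i) = n%:R * \sum_x p x * f x.
Proof.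
move=> ty; rewrite (partition_big (fun i : 'I_n => xs i) xpredT) //= mulr_sumr.
apply: eq_bigr => x _; rewrite mulrA -ty natr_sum mulr_suml big_mkcond.
by apply: eq_bigr => i _; case: eqP => [->|_]; rewrite ?mul1r ?mul0r.
Qed.

Lemma sum_eigval_ln_sqr n (M : 'M[C]_n) : density M ->
  \sum_j eigval M j * ln (eigval M j) ^+ 2 <= 4 * n%:R.
Proof.
move=> dM; apply: (@le_trans _ _ (\sum_(j < n) 4)).
  by apply: ler_sum => j _; apply: mul_ln_sqr_le4; exact: eigval_le1.
by rewrite sumr_const card_ord mulr_natr.
Qed.

(** Moves [theta] from the cell into the input word, the form to which the simulation applies. *)
Lemma adaptive_run_comp (X : Type) dA dB dE (F : 'M[C]_(dA * dE) -> 'M[C]_dB)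
    (theta : X -> 'M[C]_dE) dR rho1 Ad xs k :
  adaptive_run (env_memory_cell F theta) (dR := dR) rho1 Ad xs k =
  adaptive_run (env_memory_cell F id) rho1 Ad (theta \o xs) k.
Proof. by elim: k => [|k IH] //=; rewrite IH. Qed.

Local Arguments hprod : simpl never.
Local Arguments hprod2 : simpl never.

Section Fixed.
Variables (X : finType) (dA dB dE : nat).
Variables (F : 'M[C]_(dA * dE) -> 'M[C]_dB) (theta : X -> 'M[C]_dE).
Hypotheses (F_channel : is_channel F) (theta_density : forall x, density (theta x)).

(** [typical_test_bound] charges each message once for atypical codeword eigenvalues and twice for
    atypical eigenvectors of the average state, whence the factor 3. The remaining term is compared
    with the tensor power of the average state, common to all messages of the type, so the POVM sums
    it to at most one exponential. *)
Lemma type_class_success (dR : nat -> nat) (rho1 : 'M[C]_(dR 0 * dA))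
    (Ad : forall k, 'M[C]_(dR k * dB) -> 'M[C]_(dR k.+1 * dA)) (k : nat)
    (I : finType) (enc : I -> nat -> X) (Lam : I -> 'M[C]_(dR k * dB))
    (G : pred I) (p : X -> R) (t : R) :
  density rho1 -> (forall j, (j < k)%N -> is_channel (Ad j)) -> is_povm Lam ->
  is_distr p ->
  (forall m, G m -> forall x, (\sum_(i < k.+1) (enc m i == x))%:R = k.+1%:R * p x) ->
  0 < t ->
  \sum_(m | G m) complex.Re
     (\tr (Lam m *m adaptive_run (env_memory_cell F theta) rho1 Ad (enc m) k)) <=
  #|G|%:R * (3 * (k.+1%:R * (4 * dE%:R) / t ^+ 2)) +
  2 * expR (k.+1%:R * (nat_entropy (\sum_x (p x)%:C *: theta x) -
                       \sum_x p x * nat_entropy (theta x)) + 2 * t).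
Proof.
move=> drho chA povm dp ty t0; set n := k.+1.
set omega := \sum_x _.
have domega : density omega by case: dp => p0 p1; exact: density_mixture.
have [S [u [q [[cS ru cu thE] [qE q0 q1 muE]]]]] := ensemble_basis dp theta_density.
have [c [pc c1 cE]] := reading_test_kernels F_channel cS drho chA povm.
set eta := n%:R * (4 * dE%:R) / t ^+ 2.
pose lam m i := eigval (theta (enc m i)).
pose mu (_ : nat) := eigval omega.
(* The thresholds lie [t] above the mean of [- ln] for the average spectrum and [t] below the mean
   for the codeword spectrum, so [b - h] carries the slack [2 * t]. *)
set b := n%:R * nat_entropy omega + t.
set h := n%:R * (\sum_x p x * nat_entropy (theta x)) - t.
have lam0 m i j : 0 <= lam m i j by have /andP[] := eigval_le1 j (theta_density (enc m i)).
have mu0 i j : 0 <= mu i j by have /andP[] := eigval_le1 j domega.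
pose P (a : hist 'I_dE n) := expR (- b) <= hprod mu a.
have msgP m : G m ->
    \tr (Lam m *m adaptive_run (env_memory_cell F theta) rho1 Ad (enc m) k) <=
    (3 * eta)%:C + (2 * expR (b - h))%:C * \sum_a (hprod mu a)%:C * c m a a.
  move=> Gm; pose co i j l := \sum_z (eigval (theta (enc m i)) z)%:C *
    (u (enc m i) j z * (u (enc m i) l z)^*).
  rewrite adaptive_run_comp (cE co (theta \o enc m) (fun i => thE (enc m i))) /=.
  pose U := hprod2 (fun i => u (enc m i)) (k := n).
  pose Q (a : hist 'I_dE n) := hprod (lam m) a <= expR (- h).
  have cle1 : kpsd (fun a a' => (a == a')%:R - c m a a').
    have : kpsd (fun a a' => \sum_m' (if m' == m then 0 else c m' a a')).
      apply: kpsd_sum => m'; case: (m' == m) => // w.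
      by rewrite big1 // => a _; rewrite big1 // => a' _; rewrite mulr0 mul0r.
    apply: eq_kpsd => a a'; have := c1 a a'; rewrite (bigD1 m) //= => <-.
    rewrite addrAC subrr add0r.
    by rewrite [LHS](bigD1 m) //= eqxx add0r; apply: eq_bigr => m' /negPf ->.
  have e0 x : 0 <= (expR x)%:C by rewrite ler0c expR_ge0.
  have lamQ a : Q a -> (hprod (lam m) a)%:C <= (expR (- h))%:C by rewrite lecR.
  have rU a a' : \sum_z U a z * (U a' z)^* = (a == a')%:R by apply: hprod2_unitary.
  have cU z : \sum_a U a z * (U a z)^* = 1.
    transitivity ((z == z)%:R : C); last by rewrite eqxx.
    rewrite -(hprod2_unitary (u := fun i x y => u (enc m i) y x)) => [|i x y]; last exact: cu.
    by apply: eq_bigr => a _; rewrite !(hprod2_tr (fun i => u (enc m i))).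
  have l0 (a : hist 'I_dE n) : 0 <= (hprod (lam m) a)%:C by rewrite ler0c hprod_ge0.
  have coefE a a' : hprod2 co a a' =
      \sum_z (hprod (lam m) z)%:C * (U a z * (U a' z)^*).
    rewrite (hprod2_sum (fun i z => (lam m i z)%:C)
      (fun i => u (enc m i)) (fun i x y => (u (enc m i) x y)^*)).
    by apply: eq_bigr => z _; rewrite hprod_real -hprod2_conj.
  rewrite (eq_bigr _ (fun a _ => eq_bigr _ (fun a' _ => congr1 ( *%R^~ _) (coefE a a')))).
  apply: le_trans (typical_test_bound P (pc m) cle1 rU cU l0 (e0 _) lamQ) _.
  have tyn := ty m Gm.
  have Qbound : \sum_(a | ~~ Q a) (hprod (lam m) a)%:C <= eta%:C.
    rewrite -rmorph_sum lecR.
    have meanE : \sum_(i < n) \sum_j lam m i j * - ln (lam m i j) = h + t.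
      rewrite /h subrK; exact: (sum_type (fun x => nat_entropy (theta x)) tyn).
    apply: (le_trans (@atypical_prob _ _ (lam m) (lam m) n t Q _ _ _ _ t0 _)) => //.
    - by move=> i; exact: sum_eigval.
    - move=> a la; rewrite meanE ltr_norml => /andP[l1 l2].
      rewrite /Q -[leLHS]lnK ?posrE // ler_expR; lra.
    rewrite ler_wpM2r ?invr_ge0 ?sqr_ge0 //.
    apply: (@le_trans _ _ (\sum_(i < n) 4 * dE%:R)).
      by apply: ler_sum => i _; exact: sum_eigval_ln_sqr.
    by rewrite sumr_const card_ord -[leLHS]mulr_natl.
  (* In the eigenbasis of [omega] the diagonal of the codeword state is a product of the [q]'s,
     whose average over the type is the spectrum of [omega]; the mean of [- ln mu] is thus the
     entropy of [omega] times [n]. *)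
  have Pbound : \sum_(a | ~~ P a) \sum_z (hprod (lam m) z)%:C * (U a z * (U a z)^*)
      <= eta%:C.
    have -> : \sum_(a | ~~ P a) \sum_z (hprod (lam m) z)%:C * (U a z * (U a z)^*) =
       (\sum_(a | ~~ P a) hprod (fun i => q (enc m i)) a)%:C.
      rewrite rmorph_sum; apply: eq_bigr => a _ /=.
      rewrite -coefE hprod2_diag -hprod_real; apply: eq_hprod => i j.
      by rewrite qE.
    rewrite lecR.
    have meanE : \sum_(i < n) \sum_j q (enc m i) j * - ln (mu i j) = b - t.
      rewrite /b addrK.
      rewrite (sum_type (fun x => \sum_j q x j * - ln (eigval omega j)) tyn).
      congr (_ * _); under eq_bigr do rewrite mulr_sumr.
      rewrite exchange_big; apply: eq_bigr => j _ /=.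
      by rewrite -[in RHS]muE mulr_suml; apply: eq_bigr => x _; rewrite mulrA muE.
    apply: (le_trans (@atypical_prob _ _ (fun i => q (enc m i)) mu n t P _ _ _ _ t0 _)) => //.
    - move=> i j ik muj0.
      (* A letter that occurs in the codeword has positive weight in the type, so a zero eigenvalue
         of [omega] forces its [q] to vanish there. *)
      have pi : 0 < p (enc m i).
        have n0 : 0 < n%:R :> R by rewrite ltr0n.
        rewrite -(pmulr_rgt0 _ n0) -tyn ltr0n (bigD1 (Ordinal ik)) //= eqxx //.
      have := muE j; rewrite -/omega [X in _ = X]muj0 => /eqP.
      rewrite psumr_eq0 => [/allP/(_ (enc m i))|x _].
        by rewrite mem_index_enum => /(_ isT); rewrite mulf_eq0 gt_eqF //= => /eqP.
      by rewrite mulr_ge0 //; case: dp.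
    - move=> a la; rewrite meanE ltr_norml => /andP[l1 l2].
      rewrite /P -[leRHS]lnK ?posrE // ler_expR; lra.
    rewrite ler_wpM2r ?invr_ge0 ?sqr_ge0 //.
    rewrite (sum_type (fun x => \sum_j q x j * ln (eigval omega j) ^+ 2) tyn).
    rewrite ler_wpM2l //; apply: le_trans (sum_eigval_ln_sqr domega).
    under eq_bigr do rewrite mulr_sumr.
    rewrite exchange_big; apply: ler_sum => j _ /=.
    by rewrite -[in leRHS]muE mulr_suml; apply: ler_sum => x _; rewrite mulrA muE.
  have c0 a : 0 <= c m a a := kpsd_diag_ge0 a (pc m).
  (* On [P] each eigenvalue [hprod mu a] is at least [expR (- b)], which trades the projection for
     the tensor power of [omega]. *)
  have cP : \sum_(a | P a) c m a a <= (expR b)%:C * \sum_a (hprod mu a)%:C * c m a a.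
    rewrite mulr_sumr big_mkcond; apply: ler_sum => a _.
    case: ifPn => [Pa|_]; last first.
      by rewrite mulrA !mulr_ge0 // ler0c hprod_ge0.
    rewrite mulrA -[leLHS]mul1r ler_wpM2r // -rmorphM -(rmorph1 (real_complex R)) lecR.
    rewrite -ler_pdivrMl ?expR_gt0 // mulr1 -expRN.
    exact: Pa.
  have -> : (3 * eta)%:C = eta%:C + 2 * eta%:C by rewrite mulr_natl rmorphMn -mulr_natl /=; ring.
  rewrite lerD ?lerD ?ler_wpM2l //.
  have -> : (2 * expR (b - h))%:C = 2 * (expR (- h))%:C * (expR b)%:C.
    by rewrite addrC expRD mulr_natl rmorphMn rmorphM -mulr_natl mulrA.
  by rewrite -[leRHS]mulrA ler_wpM2l // mulr_ge0.
have ReD : {morph (@complex.Re R) : x y / x + y} by move=> [? ?] [? ?].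
rewrite -(big_morph _ ReD (erefl : complex.Re (0 : C) = 0)).
set z := \sum_(m | G m) _.
suff : z <= (#|G|%:R * (3 * eta) + 2 * expR (n%:R *
   (nat_entropy omega - \sum_x p x * nat_entropy (theta x)) + 2 * t))%:C.
  by rewrite lecE /= => /andP[_ leRe]; exact: leRe.
have -> : n%:R * (nat_entropy omega - \sum_x p x * nat_entropy (theta x)) + 2 * t = b - h.
  by rewrite /b /h; ring.
apply: (le_trans (ler_sum _ msgP)); rewrite big_split /= sumr_const rmorphD lerD //.
  by rewrite (mulr_natl (3 * eta)) rmorphMn.
rewrite -mulr_sumr -[leRHS]mulr1 ler_wpM2l ?ler0c ?mulr_ge0 ?expR_ge0 //.
(* For each [a] the diagonal entries of the test kernels sum over all messages to 1, and the weights
   [hprod mu a] also sum to 1. *)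
rewrite exchange_big /=.
have -> : 1 = \sum_(a : hist 'I_dE n) (hprod mu a)%:C.
  rewrite -rmorph_sum sum_hprod1 ?rmorph1 // => i; exact: sum_eigval.
apply: ler_sum => a _; rewrite -mulr_sumr -[leRHS]mulr1 ler_wpM2l ?ler0c ?hprod_ge0 //.
have <- : \sum_m c m a a = 1 by rewrite c1 eqxx.
rewrite big_mkcond; apply: ler_sum => m _.
by case: ifP => // _; exact: kpsd_diag_ge0.
Qed.

End Fixed.
End TypeClassBound.

(** * Entropies of classical-quantum states *)

Section HolevoQuantity.
Variable R : realType.
Local Notation C := R[i].
Local Notation "r %:C" := (real_complex R r).

(* The squared overlaps |<w_k, v_l>|^2 of two eigenbases form a doubly stochastic matrix
   supported on pairs with equal eigenvalues. *)
Lemma sum_eigval_diagonalization n (K : finType) (M : 'M[C]_n) (V : 'I_n -> K -> C)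
    (d : K -> R) (f : R -> R) :
  (forall k, 0 <= d k) ->
  (forall a b, \sum_k V a k * (V b k)^* = (a == b)%:R) ->
  (forall k l, \sum_a (V a k)^* * V a l = (k == l)%:R) ->
  (forall a b, M a b = \sum_k (d k)%:C * (V a k * (V b k)^*)) ->
  \sum_k f (eigval M k) = \sum_k f (d k).
Proof.
move=> d0 rV cV eM.
have pM : psdmx M.
  apply/psdmx_kpsd.
  have : kpsd (fun a b => \sum_k (d k)%:C * (V a k * (V b k)^*)).
    apply: kpsd_sum => k; apply: (@kpsd_mul_rank1 _ _ (fun _ _ => (d k)%:C)).
    apply: (@kpsd_comp _ _ _ (fun=> tt) (fun _ _ => (d k)%:C)) => w.
    rewrite !(@sum_hist0 _ unit) mulrAC mulr_ge0 ?ler0c //.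
    by rewrite mulrC mul_conjC_ge0.
  by apply: eq_kpsd => a b; rewrite eM.
have [W [_ rW cW eW]] := psd_spectral pM.
pose o k l := \sum_a (W a k)^* * V a l.
have ol k : \sum_l o k l * (o k l)^* = 1.
  transitivity ((k == k)%:R : C); last by rewrite eqxx.
  rewrite -cW; under eq_bigr do rewrite mulr_suml.
  rewrite exchange_big; apply: eq_bigr => a _ /=.
  under eq_bigr do rewrite rmorph_sum mulr_sumr.
  rewrite exchange_big /=.
  transitivity (\sum_b (a == b)%:R * ((W a k)^* * W b k)); last exact: sum_deltal.
  apply: eq_bigr => b _; rewrite -rV mulr_suml; apply: eq_bigr => l _.
  by rewrite rmorphM /= conjCK; ring.
have ok l : \sum_k o k l * (o k l)^* = 1.
  transitivity ((l == l)%:R : C); last by rewrite eqxx.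
  rewrite -cV; under eq_bigr do rewrite mulr_suml.
  rewrite exchange_big /=.
  transitivity (\sum_a V a l * (V a l)^*); last by apply: eq_bigr => a _; rewrite mulrC.
  apply: eq_bigr => a _.
  under eq_bigr do rewrite rmorph_sum mulr_sumr.
  rewrite exchange_big /=.
  transitivity (\sum_b (a == b)%:R * (V a l * (V b l)^*)); last exact: sum_deltal.
  apply: eq_bigr => b _; rewrite eq_sym -rW mulr_suml; apply: eq_bigr => k _.
  by rewrite rmorphM /= conjCK; ring.
(* Both sides are the matrix element of [M] between the [k]-th vector of [W] and the [l]-th vector
   of [V]. *)
have oE k l : (eigval M k)%:C * o k l = (d l)%:C * o k l.
  transitivity (\sum_b (\sum_a (W a k)^* * M a b) * V b l).
    rewrite mulr_sumr; apply: eq_bigr => b _; rewrite mulrA; congr (_ * _).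
    under [RHS]eq_bigr do rewrite eW mulr_sumr.
    rewrite exchange_big /=.
    transitivity (\sum_j (k == j)%:R * ((eigval M j)%:C * (W b j)^*)).
      by rewrite (sum_deltal (fun j => (eigval M j)%:C * (W b j)^*)).
    apply: eq_bigr => j _; rewrite -cW mulr_suml; apply: eq_bigr => a _; ring.
  under eq_bigr do rewrite mulr_suml.
  rewrite exchange_big mulr_sumr; apply: eq_bigr => a _ /=.
  under eq_bigr do rewrite eM mulr_sumr mulr_suml.
  rewrite exchange_big /=.
  transitivity (\sum_j (l == j)%:R * ((d j)%:C * ((W a k)^* * V a j))); last first.
    by rewrite (sum_deltal (fun j => (d j)%:C * ((W a k)^* * V a j))).
  apply: eq_bigr => j _; rewrite eq_sym -cV mulr_suml; apply: eq_bigr => b _; ring.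
apply: (@complexI R); rewrite !rmorph_sum /=.
transitivity (\sum_k \sum_l (f (eigval M k))%:C * (o k l * (o k l)^*)).
  by apply: eq_bigr => k _; rewrite -mulr_sumr ol mulr1.
rewrite exchange_big; apply: eq_bigr => l _ /=.
rewrite -[RHS]mulr1 -(ok l) mulr_sumr; apply: eq_bigr => k _.
have [->|o0] := eqVneq (o k l) 0; first by rewrite mul0r !mulr0.
by have /(mulIf o0)/(@complexI R) -> := oE k l.
Qed.

Lemma xlog2xE (t : R) : 0 <= t -> xlog2x t = - (t * - ln t) / ln 2.
Proof.
rewrite /xlog2x /log2 mulrN opprK le_eqVlt => /predU1P[<-|->]; last by rewrite mulrA.
by rewrite ltxx !mul0r.
Qed.

Lemma vN_entropyE n (M : 'M[C]_n) : psdmx M -> vN_entropy M = nat_entropy M / ln 2.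
Proof.
move=> /psd_spectral[_ [e0 _ _ _]]; rewrite /vN_entropy /nat_entropy -sumrN mulr_suml.
by apply: eq_bigr => k _; rewrite xlog2xE ?e0 // mulNr opprK.
Qed.

Lemma cq_stateE (X : finType) dE (p : X -> R) (theta : X -> 'M[C]_dE) i j e f :
  cq_state p theta (mxtens_index (i, e)) (mxtens_index (j, f)) =
  (i == j)%:R * ((p (enum_val i))%:C * theta (enum_val i) e f).
Proof.
rewrite /cq_state summxE (bigD1 (enum_val i)) //= big1 ?addr0 => [|x nx].
  rewrite mxE tensmxE mxE enum_valK eqxx [j == i]eq_sym /=; ring.
rewrite mxE tensmxE mxE (_ : (i == enum_rank x) = false) ?mul0r ?mulr0 //.
by apply: contraNF nx => /eqP ->; rewrite enum_rankK.
Qed.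

(** The entropy of the joint state is the Shannon entropy of [p] plus the average entropy of the
    [theta x], by the product rule [mg]; the Shannon part cancels against the entropy of the X
    marginal. *)
Lemma qmutinf_cq_state (X : finType) dE (p : X -> R) (theta : X -> 'M[C]_dE) :
  is_distr p -> (forall x, density (theta x)) ->
  qmutinf (cq_state p theta) =
  (nat_entropy (\sum_x (p x)%:C *: theta x) - \sum_x p x * nat_entropy (theta x)) / ln 2.
Proof.
move=> [p0 p1] dth; pose g (t : R) := t * - ln t.
have xg t : 0 <= t -> xlog2x t = - g t / ln 2 by exact: xlog2xE.
have mg s t : 0 <= s -> 0 <= t -> g (s * t) = t * g s + s * g t.
  rewrite /g; have [->|s0] := eqVneq s 0; first by rewrite !(mul0r, mulr0, addr0).
  have [->|t0] := eqVneq t 0; first by rewrite !(mul0r, mulr0, addr0).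
  by move=> sp tp; rewrite lnM ?posrE ?lt0r ?s0 ?t0 //; ring.
have -> : qmutinf (cq_state p theta) =
    vN_entropy (ptrace_B (cq_state p theta)) + vN_entropy (\sum_x (p x)%:C *: theta x)
    - vN_entropy (cq_state p theta).
  congr (_ + vN_entropy _ - _); apply/matrixP => e f; rewrite mxE summxE.
  rewrite (reindex (@enum_rank X)) /=; last by exists enum_val => x _;
    rewrite ?enum_rankK ?enum_valK.
  by apply: eq_bigr => x _; rewrite cq_stateE enum_rankK eqxx mul1r !mxE.
have [pom _] := density_mixture p0 p1 dth.
rewrite (vN_entropyE pom).
have -> : vN_entropy (ptrace_B (cq_state p theta)) = (\sum_x g (p x)) / ln 2.
  rewrite /vN_entropy.
  rewrite (@sum_eigval_diagonalization _ X _ (fun i x => (i == enum_rank x)%:R) p) //.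
  - by rewrite -sumrN mulr_suml; apply: eq_bigr => x _; rewrite xg ?p0 // mulNr opprK.
  - move=> i j; under eq_bigr do rewrite rmorph_nat.
    rewrite (bigD1 (enum_val i)) //= enum_valK eqxx mul1r eq_sym big1 ?addr0 // => x nx.
    by rewrite (_ : (i == enum_rank x) = false) ?mul0r //;
      apply: contraNF nx => /eqP ->; rewrite enum_rankK.
  - move=> x y; under eq_bigr do rewrite rmorph_nat.
    rewrite (bigD1 (enum_rank x)) //= eqxx mul1r (inj_eq enum_rank_inj).
    by rewrite big1 ?addr0 // => i /negPf ->; rewrite mul0r.
  - move=> i j; rewrite mxE.
    under eq_bigr do rewrite cq_stateE.
    rewrite -mulr_sumr -mulr_sumr; case: (dth (enum_val i)) => _; rewrite /mxtrace => ->.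
    rewrite mulr1 (bigD1 (enum_val i)) //= enum_valK eqxx mul1r big1 ?addr0 => [|x nx].
      by rewrite rmorph_nat eq_sym mulrC.
    rewrite (_ : (i == enum_rank x) = false) ?mul0r ?mulr0 //.
    by apply: contraNF nx => /eqP ->; rewrite enum_rankK.
have /fin_all_exists[U HU] : forall x, exists U : 'I_dE -> 'I_dE -> C,
   [/\ forall k, 0 <= eigval (theta x) k,
      forall a b, \sum_k U a k * (U b k)^* = (a == b)%:R,
      forall k l, \sum_a (U a k)^* * U a l = (k == l)%:R &
      forall a b, theta x a b = \sum_k (eigval (theta x) k)%:C * (U a k * (U b k)^*)].
  by move=> x; case: (dth x) => /psd_spectral.
have -> : vN_entropy (cq_state p theta) =
    (\sum_x g (p x) + \sum_x p x * nat_entropy (theta x)) / ln 2.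
  rewrite /vN_entropy.
  (* The eigenvectors are the basis vector of [x] tensored with eigenvectors of [theta x], with
     eigenvalues multiplied by [p x]. *)
  rewrite (@sum_eigval_diagonalization _ (X * 'I_dE)%type _
    (fun i xk => ((mxtens_unindex i).1 == enum_rank xk.1)%:R *
                  U xk.1 (mxtens_unindex i).2 xk.2)
    (fun xk => p xk.1 * eigval (theta xk.1) xk.2)).
  - rewrite -(pair_bigA _ (fun x k => xlog2x (p x * eigval (theta x) k))) /=.
    rewrite -sumrN mulrDl !mulr_suml -big_split; apply: eq_bigr => x _ /=.
    have [e0 _ _ _] := HU x.
    under eq_bigr => k _ do rewrite xg ?mulr_ge0 ?p0 ?e0 // mg ?p0 ?e0 //.
    rewrite -mulr_suml -mulNr sumrN opprK big_split /= -mulr_suml sum_eigval // mul1r.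
    by rewrite -mulr_sumr mulrDl.
  - by move=> [x k] /=; have [e0 _ _ _] := HU x; rewrite mulr_ge0.
  - move=> a b; rewrite -[a == b](can_eq (@mxtens_unindexK _ _)).
    case: (mxtens_unindex a) (mxtens_unindex b) => i e [j f] /=.
    rewrite -(pair_bigA _ (fun x k => (i == enum_rank x)%:R * U x e k *
      ((j == enum_rank x)%:R * U x f k)^*)) /=.
    rewrite (bigD1 (enum_val i)) //= [X in _ + X]big1 ?addr0 => [|x nx]; last first.
      rewrite big1 // => k _.
      rewrite (_ : (i == enum_rank x) = false) ?mul0r //.
      by apply: contraNF nx => /eqP ->; rewrite enum_rankK.
    have [_ rU _ _] := HU (enum_val i).
    rewrite enum_valK eqxx xpair_eqE -mulnb natrM -rU mulr_sumr [j == i]eq_sym.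
    by apply: eq_bigr => k _; rewrite rmorphM rmorph_nat /=; ring.
  - move=> [x k] [y l].
    rewrite (reindex (@mxtens_index #|X| dE)); last first.
      by exists (@mxtens_unindex _ _) => a _; rewrite (mxtens_indexK, mxtens_unindexK).
    under eq_bigr do rewrite mxtens_indexK.
    rewrite -(pair_bigA _ (fun i e => ((i == enum_rank x)%:R * U x e k)^* *
      ((i == enum_rank y)%:R * U y e l))) /=.
    rewrite (bigD1 (enum_rank x)) //= [X in _ + X]big1 ?addr0 => [|i /negPf ni]; last first.
      by rewrite big1 // => e _; rewrite ni mul0r rmorph0 mul0r.
    rewrite eqxx (inj_eq enum_rank_inj) xpair_eqE -mulnb natrM.
    have [<-|_] := eqVneq x y; last by rewrite mul0r big1 // => e _; rewrite !mul0r mulr0.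
    have [_ _ cU _] := HU x.
    by rewrite -cU mul1r; apply: eq_bigr => e _; rewrite !mul1r.
  - move=> a b; rewrite -[a in LHS]mxtens_unindexK -[b in LHS]mxtens_unindexK.
    case: (mxtens_unindex a) (mxtens_unindex b) => i e [j f] /=.
    rewrite cq_stateE.
    rewrite -(pair_bigA _ (fun x k => (p x * eigval (theta x) k)%:C *
      ((i == enum_rank x)%:R * U x e k * ((j == enum_rank x)%:R * U x f k)^*))) /=.
    rewrite (bigD1 (enum_val i)) //= [X in _ + X]big1 ?addr0 => [|x nx]; last first.
      rewrite big1 // => k _.
      rewrite (_ : (i == enum_rank x) = false) ?mul0r ?mulr0 //.
      by apply: contraNF nx => /eqP ->; rewrite enum_rankK.
    have [_ _ _ eU] := HU (enum_val i).
    rewrite enum_valK eqxx eU !mulr_sumr [j == i]eq_sym.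
    by apply: eq_bigr => k _; rewrite !rmorphM rmorph_nat /=; ring.
by rewrite -mulrDl -mulrBl; congr (_ / _); ring.
Qed.

End HolevoQuantity.

(** * Converse *)

Section ReadingConverse.
Variable R : realType.
Local Notation C := R[i].
Local Notation "r %:C" := (real_complex R r).

(** Messages are grouped by the type of their codeword. Types are counted as maps from [X] to counts
    between 0 and [k.+1], which gives the factor [k.+2 ^ #|X|]. *)
Lemma reading_success_bound (X : finType) (dA dB dE : nat)
    (F : 'M[C]_(dA * dE) -> 'M[C]_dB) (theta : X -> 'M[C]_dE)
    (dR : nat -> nat) (rho1 : 'M[C]_(dR 0 * dA))
    (Ad : forall k, 'M[C]_(dR k * dB) -> 'M[C]_(dR k.+1 * dA)) (k m : nat)
    (enc : 'I_m -> nat -> X) (Lam : 'I_m -> 'M[C]_(dR k * dB)) (chi t : R) :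
  is_channel F -> (forall x, density (theta x)) ->
  density rho1 -> (forall j, (j < k)%N -> is_channel (Ad j)) -> is_povm Lam ->
  (forall p : X -> R, is_distr p ->
     nat_entropy (\sum_x (p x)%:C *: theta x) - \sum_x p x * nat_entropy (theta x) <= chi) ->
  0 < t ->
  \sum_msg complex.Re
     (\tr (Lam msg *m adaptive_run (env_memory_cell F theta) rho1 Ad (enc msg) k)) <=
  m%:R * (3 * (k.+1%:R * (4 * dE%:R) / t ^+ 2)) +
  (k.+2 ^ #|X|)%:R * (2 * expR (k.+1%:R * chi + 2 * t)).
Proof.
move=> chF dth drho chA povm chiP t0; set n := k.+1.
pose cnt msg x := (\sum_(i < n) (enc msg i == x))%N.
have cnt_le msg x : (cnt msg x < n.+1)%N.
  rewrite ltnS -[leqRHS]muln1 -[n in (_ <= n * _)%N]card_ord -sum_nat_const.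
  by apply: leq_sum => i _; apply: leq_b1.
have sum_cnt msg : (\sum_x cnt msg x = n)%N.
  rewrite exchange_big /= -[RHS]muln1 -[n in RHS]card_ord -sum_nat_const.
  apply: eq_bigr => i _; rewrite (bigD1 (enc msg i)) //= eqxx big1 // => x.
  by rewrite eq_sym => /negPf ->.
pose type msg : {ffun X -> 'I_n.+1} := [ffun x => inord (cnt msg x)].
rewrite (partition_big type xpredT) //=.
set e := 2 * expR _; set eta := 3 * _.
have e0 : 0 <= e by rewrite mulr_ge0 ?expR_ge0.
have -> : m%:R * eta + (n.+1 ^ #|X|)%:R * e =
    \sum_(T : {ffun X -> 'I_n.+1}) (#|[pred msg | type msg == T]|%:R * eta + e).
  rewrite big_split /= -mulr_suml -natr_sum sumr_const card_ffun card_ord -[e *+ _]mulr_natl.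
  congr (_%:R * _ + _).
  rewrite -[LHS]card_ord -sum1_card (partition_big type xpredT) //=.
  by apply: eq_bigr => T _; rewrite -sum1_card.
apply: ler_sum => T _.
(* A map [T] that no message realizes contributes an empty sum; otherwise the witness [msg0] ensures
   that the counts in [T] add up to [n]. *)
have [msg0 T0|noT] := pickP [pred msg | type msg == T]; last first.
  by rewrite big_pred0 // (eq_card0 noT) mul0r add0r.
pose p x : R := (T x)%:R / n%:R.
have n0 : n%:R != 0 :> R by rewrite pnatr_eq0.
have cntT msg x : type msg == T -> (cnt msg x)%:R = n%:R * p x.
  by move=> /eqP eT; rewrite /p -eT ffunE inordK // mulrC divfK.
have dp : is_distr p.
  split=> [x|]; first by rewrite divr_ge0.
  apply: (mulfI n0); rewrite mulr1 mulr_sumr -[RHS](congr1 (GRing.natmul 1) (sum_cnt msg0)).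
  by rewrite natr_sum; apply: eq_bigr => x _; rewrite cntT.
have tyT msg : type msg == T -> forall x, (\sum_(i < n) (enc msg i == x))%:R = n%:R * p x.
  by move=> msgT x; exact: cntT.
apply: le_trans (type_class_success chF dth drho chA povm dp tyT t0) _.
rewrite lerD2l ler_wpM2l // ler_expR lerD2r ler_wpM2l //.
exact: chiP.
Qed.

(** One term of the exponential series suffices; the power [d.+1] exceeds the degree [d] of the type
    count by one and leaves a factor [1 / n]. *)
Lemma expRN_le_pow (y : R) (d : nat) : 0 < y -> expR (- y) <= d.+1`!%:R / y ^+ d.+1.
Proof.
move=> y0; rewrite expRN -[leRHS]invrK lef_pV2 ?posrE ?expR_gt0 //; last first.
  by rewrite invr_gt0 divr_gt0 ?ltr0n ?fact_gt0 ?exprn_gt0.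
apply: le_trans (expR_ge1Dxn d (ltW y0)).
by rewrite invf_div lerDr.
Qed.

Lemma success_bound_vanishes (D : R) (dE d : nat) : 0 < D ->
  exists N : nat, forall n : nat, (N <= n)%N -> (0 < n)%N ->
  3 * (n%:R * (4 * dE%:R) / (n%:R * (D / 8)) ^+ 2) +
  (n.+1 ^ d)%:R * (2 * expR (- (n%:R * (D / 2)))) < 3 / 4.
Proof.
move=> D0.
(* [K / n] bounds the whole expression for positive [n]: its first summand comes from Chebyshev with
   slack [n * (D / 8)], its second from [expRN_le_pow] and [n.+1 <= 2 * n]. *)
pose K := 12 * dE%:R / (D / 8) ^+ 2 +
  2 ^+ d.+1 * d.+1`!%:R / (D / 2) ^+ d.+1.
have [N NK] : exists N : nat, K * 2 < N%:R.
  exists (Num.bound `|K * 2|); apply: le_lt_trans (ler_norm _) _.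
  exact/archi_boundP/normr_ge0.
exists N => n Nn n0.
have np : 0 < n%:R :> R by rewrite ltr0n.
have nn0 : n%:R != 0 :> R by rewrite gt_eqF.
have Dn0 : D != 0 by rewrite gt_eqF.
have e1 : 3 * (n%:R * (4 * dE%:R) / (n%:R * (D / 8)) ^+ 2) =
    12 * dE%:R / (D / 8) ^+ 2 / n%:R by field; rewrite nn0 Dn0.
have e2 : (n.+1 ^ d)%:R * (2 * expR (- (n%:R * (D / 2)))) <=
    2 ^+ d.+1 * d.+1`!%:R / (D / 2) ^+ d.+1 / n%:R.
  have yp : 0 < n%:R * (D / 2) by rewrite mulr_gt0 // divr_gt0.
  have p1 : (n.+1 ^ d)%:R <= (2 * n%:R) ^+ d :> R.
    rewrite -natrM -natrX ler_nat.
    by case: d {K NK e1} => // d; rewrite leq_exp2r // mul2n -addnn -addn1 leq_add2l.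
  apply: (le_trans (ler_wpM2r _ p1)); first by rewrite mulr_ge0 ?expR_ge0.
  apply: (le_trans (ler_wpM2l _ (ler_wpM2l _ (expRN_le_pow d yp)))) => //.
  rewrite !exprMn !exprS.
  set a := n%:R ^+ d.
  have a0 : a != 0 by rewrite expf_neq0.
  rewrite le_eqVlt; apply/orP; left; apply/eqP; field.
  by rewrite nn0 a0 Dn0 !expf_neq0 // invr_eq0.
rewrite e1; apply: le_lt_trans (_ : K / n%:R < _).
  by rewrite [leRHS]mulrDl lerD2l.
rewrite ltr_pdivrMr //.
have : K * 2 < n%:R by apply: lt_le_trans NK _; rewrite ler_nat.
lra.
Qed.

End ReadingConverse.

Theorem mainTheorem5 (R : realType) (X : finType) (dA dB dE : nat)
    (F : 'M[R[i]]_(dA * dE) -> 'M[R[i]]_dB) (theta : X -> 'M[R[i]]_dE) :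
  is_channel F ->
  (forall x, density (theta x)) ->
  (reading_capacity (env_memory_cell F theta) <= max_holevo theta)%E.
Proof.
move=> chF dth; apply: ge_ereal_sup => _ [r ach <-].
rewrite leNgt; apply/negP => holevo_lt.
have ln2 : 0 < ln (2 : R) by rewrite ln_gt0 // ltr1n.
have [Cb [Cr CbP]] : exists Cb : R, Cb < r /\
    forall p, is_distr p -> qmutinf (cq_state p theta) <= Cb.
  have ub p : is_distr p -> ((qmutinf (cq_state p theta))%:E <= max_holevo theta)%E.
    by move=> dp; apply: ereal_sup_ubound; exists p.
  move: holevo_lt ub; case: (max_holevo theta) => [c| |] //.
    by rewrite lte_fin => cr ub; exists c; split=> // p /ub; rewrite lee_fin.
  (* If the supremum is minus infinity there is no distribution at all, and any number below [r] is
     a valid bound. *)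
  by move=> _ ub; exists (r - 1); split=> [|p /ub]; rewrite ?ltrBlDr ?ltrDl // leeNy_eq.
pose D := (r - Cb) * ln 2.
have D0 : 0 < D by rewrite mulr_gt0 // subr_gt0.
have [N NP] := success_bound_vanishes dE #|X| D0.
(* Error 1/4 demands success 3/4, exactly the level that [success_bound_vanishes] excludes. *)
have eps01 : 0 < (1 / 4 : R) < 1 by apply/andP; split; lra.
have delta0 : 0 < (r - Cb) / 4 by rewrite divr_gt0 // subr_gt0.
have [n0 achn] := ach _ _ eps01 delta0.
(* The successor makes the block length positive and of the form [k.+1], so that the last call has
   index [k]. *)
have [m [m0 [rate]]] := achn (maxn N n0).+1 (leqW (leq_maxr _ _)).
have Nn : (N <= (maxn N n0).+1)%N by apply: leqW; exact: leq_maxl.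
move: (maxn N n0) rate Nn => k rate Nk [_ [dR [rho1 [Ad [enc [Lam [drho chA povm succ]]]]]]].
rewrite /= in Lam povm succ.
set n := k.+1 in rate Nk *.
have np : 0 < n%:R :> R by rewrite ltr0n.
have mp : 0 < m%:R :> R by rewrite ltr0n.
have chiP p : is_distr p ->
    nat_entropy (\sum_x real_complex R (p x) *: theta x) -
    \sum_x p x * nat_entropy (theta x) <= Cb * ln 2.
  by move=> dp; rewrite -ler_pdivrMr // -qmutinf_cq_state //; exact: CbP.
have t0 : 0 < n%:R * (D / 8) by rewrite mulr_gt0 // divr_gt0.
have := reading_success_bound enc chF dth drho (fun j jk => chA j jk) povm chiP t0.
set s := \sum_msg _ in succ *; rewrite -/n => sle.
(* Of the gap [n * D] between the rate and the bound, the rate loss [(r - Cb) / 4] uses a quarter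
   and the slack [2 * t] another quarter; [n * (D / 2)] remains. *)
have mge : expR (n%:R * (Cb * ln 2) + 2 * (n%:R * (D / 8))) <=
    m%:R * expR (- (n%:R * (D / 2))).
  rewrite -[m%:R]lnK ?posrE // -expRD ler_expR.
  have : (r - (r - Cb) / 4) * n%:R * ln 2 <= ln m%:R.
    by move: rate; rewrite ler_pdivlMr // /log2 ler_pdivlMr.
  by rewrite /D; lra.
have lt34 := NP n Nk (ltn0Sn k).
have : m%:R^-1 * s < 3 / 4.
  apply: le_lt_trans lt34; rewrite ler_pdivrMl //; apply: le_trans sle _.
  by rewrite mulrDr lerD2l [leRHS]mulrCA ler_wpM2l // [leRHS]mulrCA ler_wpM2l.
by lra.
Qed.
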